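(* Let $\Pi$ be any graph structure property, and let $f(k)$ denote the time needed to check whether a candidate (a set of $k$ elements) satisfies $\Pi$. Then each of the spanning, induced, and edge variants of subgraph reconfiguration, under the TJ rule and under the TS rule, can be solved in time $O(n^{k+1}k + n^k f(k))$, where $n$ is the size of the given graph and $k$ is the size of the source (and target) solution. Furthermore, if a reconfiguration sequence between the source and target solutions exists, a shortest one can be found within the same time bound.
   Context: Graphs are finite, simple and undirected. For a graph property $\Pi$ and a graph $G$: in the edge variant, a feasible solution is an edge subset $E'\subseteq E(G)$ such that the graph formed by $E'$ (edge set $E'$ together with all endpoints of edges in $E'$) satisfies $\Pi$; in the induced variant, a feasible solution is a vertex subset $V'\subseteq V(G)$ such that the induced subgraph $G[V']$ satisfies $\Pi$; in the spanning variant, a feasible solution is a vertex subset $V'$ such that $G[V']$ contains at least one spanning subgraph satisfying $\Pi$. An ''element'' is a vertex (induced/spanning variants) or an edge (edge variant); a ''candidate'' is any set of elements; the ''size'' of a graph is its number of elements and the size of a solution is its number of elements. Under the token jumping (TJ) rule, two feasible solutions $X,Y$ are adjacent if $|X\setminus Y|=|Y\setminus X|=1$. Under the token sliding (TS) rule, they are adjacent if additionally the unique element of $X\setminus Y$ and the unique element of $Y\setminus X$ are adjacent (two vertices joined by an edge of $G$, or two edges sharing an endpoint). A reconfiguration sequence is a sequence of feasible solutions in which consecutive solutions are adjacent. The subgraph reconfiguration problem (for a given variant, rule and $\Pi$): given $G$ and feasible source and target solutions, decide whether a reconfiguration sequence from the source to the target exists. *)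

(* Defs.v *)
From HB Require Import structures.
From mathcomp Require Import all_boot.

Set Implicit Arguments.
Unset Strict Implicit.
Unset Printing Implicit Defensive.

(** * Graphs *)

Record sgraph := SGraph {
  vertex :> finType;
  adj : rel vertex;
  adj_sym : symmetric adj;
  adj_irrefl : irreflexive adj }.

Definition edges (G : sgraph) : {set {set G}} :=
  [set [set x; y] | x in G, y in G & adj x y].

Definition edge (G : sgraph) : finType := {e : {set G} | e \in edges G}.

Definition ends (G : sgraph) (e : edge G) : {set G} := sval e.

Definition isomorphic (G H : sgraph) : Prop :=
  exists2 g : G -> H, bijective g & forall x y, adj (g x) (g y) = adj x y.

Definition graph_property (Pi : sgraph -> Prop) : Prop :=
  forall G H, isomorphic G H -> Pi G -> Pi H.

Section Subgraph.
Variables (G : sgraph) (V : {set G}) (F : {set {set G}}).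

Definition sub_adj (x y : {x : G | x \in V}) : bool :=
  (x != y) && ([set val x; val y] \in F).

Lemma sub_adj_sym : symmetric sub_adj.
Proof. by move=> x y; rewrite /sub_adj eq_sym setUC. Qed.

Lemma sub_adj_irrefl : irreflexive sub_adj.
Proof. by move=> x; rewrite /sub_adj eqxx. Qed.

(* The graph with vertex set V whose edges are the pairs of vertices in F;
   members of F that are not contained in V play no role. *)
Definition subgraph : sgraph := SGraph sub_adj_sym sub_adj_irrefl.

End Subgraph.

(** * Subgraph reconfiguration *)

Variant variant := Spanning | Induced | Edge.
Variant rule := TJ | TS.

Definition element (v : variant) (G : sgraph) : finType :=
  match v with Edge => edge G | _ => vertex G end.

Definition element_adj (v : variant) (G : sgraph) : rel (element v G) :=
  match v return rel (element v G) with
  | Edge => fun e1 e2 => (e1 != e2) && (ends e1 :&: ends e2 != set0)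
  | _ => fun x y => adj x y
  end.

Definition edges_within (G : sgraph) (V : {set G}) : {set {set G}} :=
  [set e in edges G | e \subset V].

Definition feasible (v : variant) (Pi : sgraph -> Prop) (G : sgraph) :
    {set element v G} -> Prop :=
  match v return {set element v G} -> Prop with
  | Spanning => fun V =>
      exists2 F : {set {set G}}, F \subset edges_within V & Pi (subgraph V F)
  | Induced => fun V => Pi (subgraph V (edges_within V))
  | Edge => fun E =>
      Pi (subgraph (\bigcup_(e in E) ends e) [set ends e | e in E])
  end.

Definition reconf_adj (v : variant) (r : rule) (G : sgraph) :
    rel {set element v G} := fun X Y =>
  match r with
  | TJ => (#|X :\: Y| == 1) && (#|Y :\: X| == 1)
  | TS => [exists x, exists y,
             [&& X :\: Y == [set x], Y :\: X == [set y] & element_adj x y]]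
  end.

(* The sequence A :: p of sets, of length size p, leads from A to B. *)
Definition reconf_seq (v : variant) (r : rule) (Pi : sgraph -> Prop)
    (G : sgraph) (A B : {set element v G}) (p : seq {set element v G}) : Prop :=
  [/\ path (@reconf_adj v r G) A p, last A p = B
    & forall X, X \in A :: p -> feasible Pi X].

Definition shortest_reconf_seq (v : variant) (r : rule) (Pi : sgraph -> Prop)
    (G : sgraph) (A B : {set element v G}) (p : seq {set element v G}) : Prop :=
  reconf_seq r Pi A B p /\ forall q, reconf_seq r Pi A B q -> size p <= size q.

(** * Word RAM

  A machine with words of w bits (arithmetic is modulo 2 ^ w), a read-only
  input I with random access, and finitely many randomly accessible work arrays
  of 2 ^ w words, named by natural numbers.  The cost of a run is the number of
  operations performed: one for each node of each evaluated expression and one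
  for each executed instruction. *)

Variant binop := Add | Sub | Mul | Div | Mod | Eq | Lt.

Inductive expr :=
| Cst of nat
| Inp of expr                   (* word of the input *)
| Get of nat & expr             (* word of the given work array *)
| Bin of binop & expr & expr.

Inductive com :=
| Skip
| Put of nat & expr & expr      (* array name, index, value *)
| Seq of com & com
| If of expr & com & com
| While of expr & com.

Definition store := nat -> nat -> nat.

Definition update (s : store) (a i x : nat) : store :=
  fun b j => if (b == a) && (j == i) then x else s b j.

(* Sub is truncated at 0. *)
Definition eval_binop (o : binop) (x y : nat) : nat :=
  match o with
  | Add => x + y
  | Sub => x - y
  | Mul => x * y
  | Div => x %/ y
  | Mod => x %% y
  | Eq => x == y
  | Lt => x < y
  end.

Fixpoint eval (w : nat) (I : seq nat) (s : store) (e : expr) : nat :=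
  match e with
  | Cst c => c
  | Inp e1 => nth 0 I (eval w I s e1)
  | Get a e1 => s a (eval w I s e1)
  | Bin o e1 e2 => eval_binop o (eval w I s e1) (eval w I s e2)
  end %% 2 ^ w.

Fixpoint cost (e : expr) : nat :=
  match e with
  | Cst _ => 1
  | Inp e1 => (cost e1).+1
  | Get _ e1 => (cost e1).+1
  | Bin _ e1 e2 => (cost e1 + cost e2).+1
  end.

(* exec w I c s t s': started in s, the program c halts in s' after t steps. *)
Inductive exec (w : nat) (I : seq nat) : com -> store -> nat -> store -> Prop :=
| ExecSkip s : exec w I Skip s 1 s
| ExecPut a e1 e2 s :
    exec w I (Put a e1 e2) s (cost e1 + cost e2).+1
      (update s a (eval w I s e1) (eval w I s e2))
| ExecSeq c1 c2 s t1 s1 t2 s2 :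
    exec w I c1 s t1 s1 -> exec w I c2 s1 t2 s2 ->
    exec w I (Seq c1 c2) s (t1 + t2) s2
| ExecIf e c1 c2 s t s' :
    exec w I (if eval w I s e != 0 then c1 else c2) s t s' ->
    exec w I (If e c1 c2) s (cost e + t).+1 s'
| ExecWhileStop e c s :
    eval w I s e = 0 -> exec w I (While e c) s (cost e).+1 s
| ExecWhileStep e c s t1 s1 t2 s2 :
    eval w I s e != 0 ->
    exec w I c s t1 s1 -> exec w I (While e c) s1 t2 s2 ->
    exec w I (While e c) s (cost e + t1 + t2).+1 s2.

(* Arguments and results are passed at the beginning of work array 0. *)
Definition stored (s : store) (l : seq nat) : Prop :=
  forall i, i < size l -> s 0 i = nth 0 l i.

(* No assumption is made on the contents of the memory beyond the arguments. *)
Definition runs (w : nat) (I : seq nat) (P : com) (args : seq nat) (t : nat)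
    (post : seq nat -> Prop) : Prop :=
  forall s, stored s args ->
  exists t' s' out,
    [/\ exec w I P s t' s', t' <= t, stored s' out & post out].

(** * Encodings and time bounds *)

(* Numbers of vertices and edges, adjacency matrix row by row, list of the two
   endpoints of each edge. *)
Definition encode (G : sgraph) : seq nat :=
  [:: #|G|; #|edge G|]
  ++ [seq nat_of_bool (adj x y) | x <- enum G, y <- enum G]
  ++ flatten [seq [seq nat_of_ord (enum_rank x) | x <- enum (ends e)]
             | e <- enum (edge G)].

(* The increasing list of the numbers of the elements of X. *)
Definition code (T : finType) (X : {set T}) : seq nat :=
  [seq nat_of_ord (enum_rank x) | x <- enum X].

(* In the next two definitions the word length is required to be only at least
   logarithmic in the input length plus the time bound, up to a constant factor
   under the logarithm. *)

(* D checks whether a candidate of k elements is feasible in time f k. *)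
Definition checks_in_time (v : variant) (Pi : sgraph -> Prop) (f : nat -> nat)
    (D : com) : Prop :=
  exists c, forall (w : nat) (G : sgraph) (X : {set element v G}),
    c * (size (encode G) + f #|X|) <= 2 ^ w ->
    runs w (encode G) D (#|X| :: code X) (f #|X|)
      (fun out => exists2 b : bool, out = [:: nat_of_bool b]
                                  & b <-> feasible Pi X).

(* The output is 0 if no reconfiguration sequence exists, and otherwise 1,
   followed by the length of a shortest one and by its sets. *)
Definition correct_output (v : variant) (r : rule) (Pi : sgraph -> Prop)
    (G : sgraph) (A B : {set element v G}) (out : seq nat) : Prop :=
  (exists2 p, shortest_reconf_seq r Pi A B p
            & out = 1 :: size p :: flatten [seq code X | X <- A :: p])
  \/ ((forall p, ~ reconf_seq r Pi A B p) /\ out = [:: 0]).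

(* P solves the reconfiguration problem in time T n k, where n is the number of
   elements of the graph and k that of the source and target solutions. *)
Definition solves_in_time (v : variant) (r : rule) (Pi : sgraph -> Prop)
    (T : nat -> nat -> nat) (P : com) : Prop :=
  exists c, forall (w : nat) (G : sgraph) (A B : {set element v G}) (k : nat),
    feasible Pi A -> feasible Pi B -> #|A| = k -> #|B| = k ->
    c * (size (encode G) + T #|element v G| k) <= 2 ^ w ->
    runs w (encode G) P (k :: code A ++ code B) (T #|element v G| k)
      (correct_output r Pi A B).

(* Main.v *)
Require Import Defs.
From mathcomp Require Import all_boot zify.

(* Breadth-first search over ordered solutions.  A node is a number c < n ^ k
   whose k digits in base n name the elements of a candidate in some order, so
   that a token move changes one digit and the k * n neighbours of a node are
   found in constant time each, by arithmetic and table lookup.  For each node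
   the sorted list of its digits is computed in time O(n k); if it has length k
   it is passed to the given checker, which takes time f k.  The search starts
   from all orderings of the target at once: a sequence of solutions starting
   at the set of a node lifts uniquely to a sequence of nodes starting at that
   node, but the order in which the tokens reach the target is not known in
   advance.  The parent pointers, followed from the source, then give a shortest
   sequence.  The checker may overwrite any array that it mentions, so all other
   data are kept in arrays with larger names. *)

Set Implicit Arguments.
Unset Strict Implicit.
Unset Printing Implicit Defensive.

(** * Time-bounded weakest preconditions *)

(** Naming solutions by unordered sets would require a ranking of k-sets or a dictionary to locate a
    neighbour, which costs more than constant time. Ordered tuples avoid this: a k-set has k! nodes,
    still within the n ^ k of the bound, and tuples with a repeated digit are discarded because
    their sorted list is shorter than k. Distances are unaffected: with all orderings of the target
    as sources, a node is as far from the sources as its set is from the target. The proof has two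
    halves that meet in [outcome]. The program logic speaks of numbers only and carries time bounds
    and word overflow along; the graph half never mentions a store. A specification by [runs]
    assumes nothing about the memory, so the checker can be called again and again on a used store;
    for the same reason every table entry must be initialised explicitly. The case k = 0 stands
    apart: there is no digit to change, n may be 0, and the time bound reduces to a multiple of f 0,
    which is positive only because every run takes at least one step. *)

Fixpoint writes (c : com) : seq nat :=
  match c with
  | Skip => [::]
  | Put a _ _ => [:: a]
  | Seq c1 c2 | If _ c1 c2 => writes c1 ++ writes c2
  | While _ c1 => writes c1
  end.

Section Logic.
Variables (w : nat) (I : seq nat).

Definition wp (c : com) (t : nat) (Q : store -> Prop) (s : store) : Prop :=
  exists t' s', [/\ exec w I c s t' s', t' <= t & Q s'].

(** Frame condition. The rules for sequences and loops hand it to the continuation, so that an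
    invariant mentions only what its loop changes. *)
Definition agree (l : seq nat) (s s' : store) : Prop :=
  forall a, a \notin l -> s' a = s a.

Lemma exec_agree c s t s' : exec w I c s t s' -> agree (writes c) s s'.
Proof.
elim=> {c s t s'} //=.
- by move=> a e1 e2 s b; rewrite inE /update => /negbTE->.
- move=> c1 c2 s t1 s1 t2 s2 _ IH1 _ IH2 a.
  by rewrite mem_cat negb_or => /andP[a1 a2]; rewrite IH2 ?IH1.
- move=> e c1 c2 s t s' _ IH a.
  by rewrite mem_cat negb_or => /andP[a1 a2]; apply: IH; case: ifP.
- by move=> e c s t1 s1 t2 s2 _ _ IH1 _ IH2 a Ha; rewrite IH2 ?IH1.
Qed.

Lemma exec_gt0 c s t s' : exec w I c s t s' -> 0 < t.
Proof. by elim=> //= *; rewrite addn_gt0; apply/orP; left. Qed.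

Lemma wp_weaken c t t' (Q Q' : store -> Prop) s :
  wp c t Q s -> t <= t' ->
  (forall s', Q s' -> agree (writes c) s s' -> Q' s') -> wp c t' Q' s.
Proof.
move=> [u [s' [Es le_u Qs]]] le_t QQ; exists u, s'; split => //.
  exact: leq_trans le_t.
by apply: QQ => //; apply: exec_agree Es.
Qed.

Lemma wp_skip t (Q : store -> Prop) s : 0 < t -> Q s -> wp Skip t Q s.
Proof. by move=> t0 Qs; exists 1, s; split=> //; constructor. Qed.

Lemma wp_put a e1 e2 t (Q : store -> Prop) s i v :
  eval w I s e1 = i -> eval w I s e2 = v -> cost e1 + cost e2 < t ->
  Q (update s a i v) -> wp (Put a e1 e2) t Q s.
Proof.
move=> <- <- le_t Qs; exists (cost e1 + cost e2).+1; eexists.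
by split; [constructor | |].
Qed.

Lemma wp_seq t1 c1 c2 t Q1 Q s :
  wp c1 t1 Q1 s -> t1 <= t ->
  (forall s', Q1 s' -> agree (writes c1) s s' -> wp c2 (t - t1) Q s') ->
  wp (Seq c1 c2) t Q s.
Proof.
move=> [u [s1 [E1 le_u Qs1]]] le_t H2.
have [u2 [s2 [E2 le_u2 Qs2]]] := H2 _ Qs1 (exec_agree E1).
exists (u + u2), s2; split=> //; first exact: ExecSeq E1 E2.
lia.
Qed.

Lemma wp_put_seq a e1 e2 c t (Q : store -> Prop) s i v :
  eval w I s e1 = i -> eval w I s e2 = v -> cost e1 + cost e2 < t ->
  wp c (t - (cost e1 + cost e2).+1) Q (update s a i v) ->
  wp (Seq (Put a e1 e2) c) t Q s.
Proof.
move=> E1 E2 le_t [u [s' [Es le_u Qs]]].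
exists ((cost e1 + cost e2).+1 + u), s'; split=> //; last lia.
by apply: ExecSeq Es; rewrite -E1 -E2; constructor.
Qed.

Lemma wp_if e c1 c2 t Q s v :
  eval w I s e = v -> cost e < t ->
  (v != 0 -> wp c1 (t - (cost e).+1) Q s) ->
  (v = 0 -> wp c2 (t - (cost e).+1) Q s) ->
  wp (If e c1 c2) t Q s.
Proof.
move=> Ev le_t H1 H2.
have [u [s' [Es le_u Qs]]] :
    wp (if eval w I s e != 0 then c1 else c2) (t - (cost e).+1) Q s.
  by rewrite Ev; case: eqP => [/H2 | /eqP/H1].
exists (cost e + u).+1, s'; split=> //; last lia.
by constructor.
Qed.

(** Induction on the number of rounds left. In [Inv j] the index j counts completed rounds; after m
    of them the second alternative is impossible, so the loop stops. The extra [(cost e).+1] pays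
    for the last, failing test. The frame condition is relative to the store before the loop, not
    before the round. *)
Lemma wp_while e c m tb (Inv : nat -> store -> Prop) (Q : store -> Prop) t s :
  Inv 0 s ->
  m * (tb + cost e).+1 + (cost e).+1 <= t ->
  (forall j s', Inv j s' -> agree (writes c) s s' ->
     (eval w I s' e = 0 /\ Q s') \/
     [/\ j < m, eval w I s' e != 0 & wp c tb (Inv j.+1) s']) ->
  wp (While e c) t Q s.
Proof.
move=> Inv0 le_t step.
have aux d : forall j s', j + d = m -> Inv j s' -> agree (writes c) s s' ->
    wp (While e c) (d * (tb + cost e).+1 + (cost e).+1) Q s'.
  elim: d => [|d IHd] j s' jd Is ag.
    have [[e0 Qs]|[]] := step j s' Is ag; last by lia.
    by exists (cost e).+1, s'; split=> //; constructor.
  have [[e0 Qs]|[ltj ne0 [u [s1 [E1 le_u Is1]]]]] := step j s' Is ag.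
    by exists (cost e).+1, s'; split=> //; [constructor | lia].
  have ag1 : agree (writes c) s s1.
    by move=> a Ha; rewrite (exec_agree E1) ?ag.
  have [u2 [s2 [E2 le_u2 Qs2]]] := IHd j.+1 s1 ltac:(lia) Is1 ag1.
  exists (cost e + u + u2).+1, s2; split=> //.
    exact: ExecWhileStep E1 E2.
  by rewrite mulSn; lia.
have [u [s' [Es le_u Qs]]] := aux m 0 s (add0n m) Inv0 (fun _ _ => erefl).
by exists u, s'; split=> //; apply: leq_trans le_t.
Qed.

Lemma ev_cst s c : c < 2 ^ w -> eval w I s (Cst c) = c.
Proof. exact: modn_small. Qed.

Lemma ev_get s a e i v :
  eval w I s e = i -> s a i = v -> v < 2 ^ w -> eval w I s (Get a e) = v.
Proof. by move=> /= -> ->; apply: modn_small. Qed.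

Lemma ev_inp s e i v :
  eval w I s e = i -> nth 0 I i = v -> v < 2 ^ w -> eval w I s (Inp e) = v.
Proof. by move=> /= -> ->; apply: modn_small. Qed.

Lemma ev_bin s o e1 e2 x y v :
  eval w I s e1 = x -> eval w I s e2 = y -> eval_binop o x y = v ->
  v < 2 ^ w -> eval w I s (Bin o e1 e2) = v.
Proof. by move=> /= -> -> ->; apply: modn_small. Qed.

End Logic.

(** * Numbers as tuples of digits *)

Section Digits.
Variables (n : nat) (n_gt0 : 0 < n).

Definition dig (c i : nat) : nat := c %/ n ^ i %% n.

(** The form that the machine computes: the difference is formed once per digit position, the last
    summand once per y. Truncated subtraction is exact here by [dig_le]. *)
Definition rep (c i y : nat) : nat := c - dig c i * n ^ i + y * n ^ i.

Lemma dig_lt c i : dig c i < n.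
Proof. exact: ltn_pmod. Qed.

Lemma dig_le c i : dig c i * n ^ i <= c.
Proof.
apply: leq_trans (leq_divM c (n ^ i)).
by rewrite leq_mul2r leq_mod orbT.
Qed.

Lemma repE c i y :
  rep c i y = (c %/ n ^ i.+1 * n + y) * n ^ i + c %% n ^ i.
Proof.
have -> : c %/ n ^ i.+1 = c %/ n ^ i %/ n by rewrite expnSr divnMA.
rewrite /rep {1}(divn_eq c (n ^ i)) {1}(divn_eq (c %/ n ^ i) n) -/(dig c i).
rewrite !mulnDl; move: (_ * n * _) (dig _ _ * _) (_ %% _) => p q r; lia.
Qed.

Lemma dig_rep c i y j :
  y < n -> dig (rep c i y) j = if j == i then y else dig c j.
Proof.
move=> lt_y; have ni : 0 < n ^ i by rewrite expn_gt0 n_gt0.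
have [ltji|ltij|->] := ltngtP j i.
(* Digits below position i are blind to multiples of n ^ i, since n ^ i is a multiple of n ^
   j.+1. *)
- have low a : dig (a * n ^ i + c %% n ^ i) j = dig (c %% n ^ i) j.
    have -> : n ^ i = n ^ (i - j.+1) * n * n ^ j.
      by rewrite -mulnA -expnS -expnD; congr (_ ^ _); lia.
    rewrite /dig mulnA divnMDl ?expn_gt0 ?n_gt0 // mulnA modnMDl.
    by [].
  by rewrite repE low -(low (c %/ n ^ i)) -divn_eq.
- have high a : dig (a * n ^ i + c %% n ^ i) j = dig (a %/ n) (j - i.+1).
    have -> : dig (a * n ^ i + c %% n ^ i) j =
        dig (a * n ^ i + c %% n ^ i) (i + (j - i.+1).+1) by congr dig; lia.
    rewrite /dig expnD divnMA divnMDl // (@divn_small (c %% _)) ?ltn_pmod //.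
    by rewrite addn0 expnS divnMA.
  rewrite repE high divnMDl // (divn_small lt_y) addn0.
  by rewrite {2}(divn_eq c (n ^ i)) high -divnMA -expnSr.
- rewrite repE /dig divnMDl // (@divn_small (c %% _)) ?ltn_pmod // addn0.
  by rewrite modnMDl modn_small.
Qed.

Lemma rep_lt c i y k : c < n ^ k -> i < k -> y < n -> rep c i y < n ^ k.
Proof.
move=> lt_c lt_i lt_y; have ni : 0 < n ^ i by rewrite expn_gt0 n_gt0.
have Ek : n ^ k = n ^ (k - i.+1) * n ^ i.+1 by rewrite -expnD subnK.
have le_q : c %/ n ^ i.+1 < n ^ (k - i.+1).
  by rewrite ltn_divLR ?expn_gt0 ?n_gt0 // -Ek.
rewrite Ek expnS mulnA repE.
have lt_m : c %% n ^ i < n ^ i by rewrite ltn_pmod.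
apply: (@leq_trans ((c %/ n ^ i.+1 * n + y).+1 * n ^ i)).
  by rewrite mulSn addnC ltn_add2r.
rewrite leq_mul2r; apply/orP; right.
apply: (@leq_trans ((c %/ n ^ i.+1).+1 * n)); first by rewrite mulSn; lia.
by rewrite leq_mul2r le_q orbT.
Qed.

(** Lets a token move be traversed backwards, as the search from the target requires. *)
Lemma rep_dig c i y : y < n -> rep (rep c i y) i (dig c i) = c.
Proof.
move=> lt_y; rewrite {1}/rep dig_rep // eqxx {1}/rep addnK subnK //.
exact: dig_le.
Qed.

Lemma dig_small c i : c < n ^ i -> dig c i = 0.
Proof. by move=> lt_c; rewrite /dig divn_small ?mod0n. Qed.

Fixpoint numeral (l : seq nat) (i : nat) : nat :=
  if i is i'.+1 then numeral l i' + nth 0 l i' * n ^ i' else 0.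

Lemma numeral_lt l k : (forall i, i < k -> nth 0 l i < n) ->
  forall i, i <= k -> numeral l i < n ^ i.
Proof.
move=> l_lt; elim=> // i IH lt_i /=; have := IH (ltnW lt_i).
have := l_lt _ lt_i.
by rewrite expnS; move: (n ^ i) (numeral _ _) (nth _ _ _) => p q r; nia.
Qed.

Lemma dig_numeral l k : (forall i, i < k -> nth 0 l i < n) ->
  forall i j, j < i -> i <= k -> dig (numeral l i) j = nth 0 l j.
Proof.
move=> l_lt; elim=> // i IH j lt_j lt_i /=.
have Er : numeral l i + nth 0 l i * n ^ i = rep (numeral l i) i (nth 0 l i).
  by rewrite /rep dig_small ?subn0 // (numeral_lt l_lt) // ltnW.
rewrite Er dig_rep ?l_lt //.
by case: eqP => [->|ne] //; rewrite IH //; lia.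
Qed.

End Digits.

(** * Breadth-first search *)

Section Search.
Variables (feas src : pred nat) (nb : nat -> nat -> Prop).

(* Q lists the reached nodes in order, those before position h being
   expanded; distances are shifted by 1, so that 0 can mean unreached. *)
Record bfs (Q : seq nat) (h : nat) (d par : nat -> nat) : Prop := Bfs {
  bfs_uniq : uniq Q;
  bfs_feas : forall c, c \in Q -> feas c;
  bfs_src : forall c, src c -> c \in Q /\ d c = 1;
  bfs_dist : forall c, c \in Q -> 0 < d c <= (index c Q).+1;
  bfs_par : forall c, c \in Q ->
    (d c = 1 /\ src c) \/
    [/\ par c \in Q, nb (par c) c & d c = (d (par c)).+1];
  bfs_mono : forall a b, a \in Q -> b \in Q ->
    index a Q <= index b Q -> d a <= d b;
  bfs_head : h < size Q -> forall c, c \in Q -> d c <= (d (nth 0 Q h)).+1 }.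

(** An inequality, because a neighbour of u may have been found earlier, at a smaller distance; it
    is enough to bound sequence lengths from below. *)
Definition reached (Q : seq nat) (d : nat -> nat) (u c : nat) : Prop :=
  c \in Q /\ d c <= (d u).+1.

Lemma bfs_init Q d par :
  uniq Q -> (forall c, c \in Q = src c) -> (forall c, src c -> feas c) ->
  (forall c, src c -> d c = 1) -> bfs Q 0 d par.
Proof.
move=> uQ QE sf d1; split=> // [c|c|c|c|a b|h0 c]; rewrite ?QE //.
- exact: sf.
- by move=> sc; split; last exact: d1.
- by move/d1->.
- by move=> sc; left; rewrite d1.
- by move=> /d1-> /d1->.
- by move/d1->.
Qed.

Lemma bfs_next Q h d par : h < size Q -> bfs Q h d par -> bfs Q h.+1 d par.
Proof.
move=> ltQ b; split; try by case: b.
move=> ltQ1 c cQ; apply: leq_trans (bfs_head b ltQ cQ) _.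
rewrite ltnS; apply: (bfs_mono b); rewrite ?mem_nth //.
by rewrite !index_uniq ?(bfs_uniq b).
Qed.

(** By [bfs_head] no queued node is farther than d u + 1, so appending c at that distance keeps the
    queue sorted by distance. *)
Lemma bfs_push Q h d par d' par' c :
  let u := nth 0 Q h in
  h < size Q -> bfs Q h d par -> feas c -> c \notin Q -> nb u c ->
  d' c = (d u).+1 -> (forall a, a != c -> d' a = d a) ->
  par' c = u -> (forall a, a != c -> par' a = par a) ->
  bfs (rcons Q c) h d' par'.
Proof.
move=> u ltQ b fc cQ nbc d'c d'E par'c par'E.
have uQ : u \in Q by rewrite mem_nth.
have neq a : a \in Q -> a != c by apply: contraL => /eqP->.
have d'Q a : a \in Q -> d' a = d a by move=> /neq/d'E.
have par'Q a : a \in Q -> par' a = par a by move=> /neq/par'E.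
have idxQ a : a \in Q -> index a (rcons Q c) = index a Q.
  by move=> aQ; rewrite -cats1 index_cat aQ.
have idxc : index c (rcons Q c) = size Q.
  by rewrite -cats1 index_cat (negbTE cQ) /= eqxx addn0.
have inE' a : a \in rcons Q c -> a = c \/ a \in Q.
  by rewrite mem_rcons inE => /orP[/eqP|]; [left | right].
split.
- by rewrite rcons_uniq cQ (bfs_uniq b).
- by move=> a /inE'[->|/(bfs_feas b)].
- by move=> a /(bfs_src b)[aQ da]; rewrite mem_rcons inE aQ orbT d'Q.
- move=> a /inE'[->|aQ]; last by rewrite d'Q // idxQ // (bfs_dist b).
  rewrite d'c idxc /=; case/andP: (bfs_dist b uQ) => _ le_d.
  by apply: leq_ltn_trans le_d _; rewrite ltnS index_uniq ?(bfs_uniq b).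
- move=> a /inE'[->|aQ].
    by right; rewrite par'c mem_rcons inE uQ orbT d'c d'Q.
  rewrite d'Q // par'Q //; case: (bfs_par b aQ) => [|[pQ nba ->]]; first by left.
  by right; rewrite mem_rcons inE pQ orbT d'Q.
- move=> a a' /inE'[->|aQ] /inE'[->|aQ'] //.
  + by rewrite idxc idxQ // => le; rewrite leqNgt index_mem aQ' in le.
  + by move=> _; rewrite d'c (d'Q a aQ) (bfs_head b).
  + by rewrite !idxQ // !d'Q //; apply: (bfs_mono b).
- move=> _ a; rewrite nth_rcons ltQ -/u (d'Q u uQ).
  by case/inE'=> [->|aQ]; rewrite ?d'c // d'Q // (bfs_head b).
Qed.

(** A node with distance above 1 is no source, so it has a parent in the queue, exactly one
    closer. *)
Lemma bfs_chain Q h d par c j :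
  bfs Q h d par -> c \in Q -> j < d c ->
  iter j par c \in Q /\ d (iter j par c) = d c - j.
Proof.
move=> b cQ; elim: j => [|j IH] lt_j; first by rewrite subn0.
have [iQ di] := IH (ltnW lt_j).
rewrite iterS; case: (bfs_par b iQ) => [[d1 _]|[pQ _ dp]]; first lia.
by split=> //; lia.
Qed.

End Search.

(** * The program *)

Section Program.
Variables (D : com) (M : nat).

(* Arrays fr 0, ..., fr 5 hold n, k, the powers of n, n ^ k, the node of the
   source and the sorted list of the target.  Then come 6: current node;
   7: output position; 8: candidate element y; 9: flag; 10: digit position i;
   11: whether a node is feasible and unreached; 12: its distance plus 1, or 0
   if unreached; 13: its parent; 14, 15, 16: the queue, its length and its head;
   17: node u being expanded; 18: digit i of u; 19: u with digit i cleared;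
   20: comparison result, later a counter; 21: number of sets to print. *)
Definition fr (j : nat) : nat := M + j.+1.
Variables (nE adjE : expr).

Local Notation V j := (Get (fr j) (Cst 0)).
Local Notation Let j e := (Put (fr j) (Cst 0) e).
Local Notation incr j := (Put (fr j) (Cst 0) (Bin Add (V j) (Cst 1))).
Local Notation "c1 ;; c2" := (Seq c1 c2)
  (at level 70, right associativity, only parsing).

Definition digitE (j : nat) : expr :=
  Bin Mod (Bin Div (V j) (Get (fr 2) (V 10))) (V 0).

Definition scan : com :=
  If (Bin Eq (digitE 6) (V 8)) (Let 9 (Cst 1)) Skip ;; incr 10.

Definition emit_body : com :=
  Let 9 (Cst 0) ;; Let 10 (Cst 0) ;;
  While (Bin Lt (V 10) (V 1)) scan ;;
  If (V 9) (Put 0 (V 7) (V 8) ;; incr 7) Skip ;; incr 8.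

Definition emit : com :=
  Let 8 (Cst 0) ;; While (Bin Lt (V 8) (V 0)) emit_body.

(** Array 0 holds k, then the source from index 1 and the target from index k + 1. Both are saved
    here because array 0 is reused for the arguments of the checker and for the output. *)
Definition init_body : com :=
  Put (fr 2) (V 10) (V 3) ;;
  Put (fr 5) (V 10) (Get 0 (Bin Add (V 10) (Bin Add (V 1) (Cst 1)))) ;;
  Let 4 (Bin Add (V 4) (Bin Mul (Get 0 (Bin Add (V 10) (Cst 1))) (V 3))) ;;
  Let 3 (Bin Mul (V 3) (V 0)) ;; incr 10.

Definition init : com :=
  Let 0 nE ;; Let 1 (Get 0 (Cst 0)) ;; Let 10 (Cst 0) ;; Let 3 (Cst 1) ;;
  Let 4 (Cst 0) ;; While (Bin Lt (V 10) (V 1)) init_body.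

Definition compare : com :=
  Let 20 (Cst 1) ;; Let 10 (Cst 0) ;;
  While (Bin Lt (V 10) (V 1))
    (Let 20 (Bin Mul (V 20) (Bin Eq (Get 0 (Bin Add (V 10) (Cst 1)))
                                    (Get (fr 5) (V 10)))) ;;
     incr 10).

(* Sources need no call of the checker, the target being feasible. *)
Definition classify : com :=
  If (Bin Eq (V 7) (Bin Add (V 1) (Cst 1)))
    (compare ;;
     If (V 20)
       (Put (fr 14) (V 15) (V 6) ;; Put (fr 12) (V 6) (Cst 1) ;; incr 15)
       (Put 0 (Cst 0) (V 1) ;; D ;; Put (fr 11) (V 6) (Get 0 (Cst 0))))
    Skip.

Definition enumerate_body : com :=
  Let 7 (Cst 1) ;; emit ;;
  Put (fr 11) (V 6) (Cst 0) ;; Put (fr 12) (V 6) (Cst 0) ;;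
  classify ;; incr 6.

Definition enumerate : com :=
  Let 15 (Cst 0) ;; Let 6 (Cst 0) ;;
  While (Bin Lt (V 6) (V 3)) enumerate_body.

Definition visit : com :=
  Let 6 (Bin Add (V 19) (Bin Mul (V 8) (Get (fr 2) (V 10)))) ;;
  If (Get (fr 11) (V 6))
    (If adjE
       (Put (fr 11) (V 6) (Cst 0) ;; Put (fr 14) (V 15) (V 6) ;;
        Put (fr 13) (V 6) (V 17) ;;
        Put (fr 12) (V 6) (Bin Add (Get (fr 12) (V 17)) (Cst 1)) ;; incr 15)
       Skip)
    Skip ;;
  incr 8.

Definition row : com :=
  Let 18 (digitE 17) ;;
  Let 19 (Bin Defs.Sub (V 17) (Bin Mul (V 18) (Get (fr 2) (V 10)))) ;;
  Let 8 (Cst 0) ;; While (Bin Lt (V 8) (V 0)) visit ;; incr 10.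

Definition expand : com :=
  Let 17 (Get (fr 14) (V 16)) ;; Let 10 (Cst 0) ;;
  While (Bin Lt (V 10) (V 1)) row ;; incr 16.

Definition search : com :=
  Let 16 (Cst 0) ;; While (Bin Lt (V 16) (V 15)) expand.

(** Since the search starts from the target, parents lead from the source forwards and the sets come
    out in the right order. With distances shifted by 1, the stored distance of the source is the
    number of sets and one less is the length. *)
Definition output : com :=
  If (Get (fr 12) (V 4))
    (Put 0 (Cst 0) (Cst 1) ;;
     Put 0 (Cst 1) (Bin Defs.Sub (Get (fr 12) (V 4)) (Cst 1)) ;;
     Let 21 (Get (fr 12) (V 4)) ;; Let 7 (Cst 2) ;; Let 6 (V 4) ;;
     Let 20 (Cst 0) ;;
     While (Bin Lt (V 20) (V 21))
       (emit ;; Let 6 (Get (fr 13) (V 6)) ;; incr 20))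
    (Put 0 (Cst 0) (Cst 0)).

Definition main : com := init ;; enumerate ;; search ;; output.

Arguments update : simpl never.

(** * Correctness and running time of the program, in terms of numbers only *)

Section Correctness.
Variables (w : nat) (I : seq nat) (n k ca : nat) (codeA codeB : seq nat).
Local Notation N := (n ^ k).
Hypotheses (n_gt0 : 0 < n) (k_gt0 : 0 < k) (le_kn : k <= n).
Hypothesis word_gt : 100 + 10 * (N * n * k) < 2 ^ w.

Lemma frE i j : (fr i == fr j) = (i == j).
Proof. by rewrite /fr eqn_add2l eqSS. Qed.
Lemma fr0E i : (fr i == 0) = false.
Proof. by rewrite /fr addnS. Qed.
Lemma fr0E' i : (0 == fr i) = false.
Proof. by rewrite /fr addnS. Qed.

Lemma upd_fr s i j x p a :
  update s (fr i) a x (fr j) p = if (j == i) && (p == a) then x else s (fr j) p.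
Proof. by rewrite /update frE. Qed.
Lemma upd_fr0 s i x p a : update s (fr i) a x 0 p = s 0 p.
Proof. by rewrite /update fr0E'. Qed.
Lemma upd_0fr s j x p a : update s 0 a x (fr j) p = s (fr j) p.
Proof. by rewrite /update fr0E. Qed.
Lemma upd_00 s x p a : update s 0 a x 0 p = if p == a then x else s 0 p.
Proof. by rewrite /update. Qed.
Definition updE := (upd_fr, upd_fr0, upd_0fr, upd_00).

Definition glob (s : store) : Prop :=
  [/\ s (fr 0) 0 = n, s (fr 1) 0 = k, forall i, i < k -> s (fr 2) i = n ^ i
    & [/\ s (fr 3) 0 = N, s (fr 4) 0 = ca
        & forall i, i < k -> s (fr 5) i = nth 0 codeB i]].

Lemma glob_eq s s' :
  (forall j a, j < 6 -> s' (fr j) a = s (fr j) a) -> glob s -> glob s'.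
Proof.
move=> E [G0 G1 G2 [G3 G4 G5]]; split; rewrite ?E //.
  by move=> i /G2 <-; rewrite E.
by split; rewrite ?E // => i /G5 <-; rewrite E.
Qed.

Lemma glob_upd s j a x : 6 <= j -> glob s -> glob (update s (fr j) a x).
Proof.
move=> le_j; apply: glob_eq => i b lt_i; rewrite updE.
by have -> : (i == j) = false by lia.
Qed.

Lemma glob_upd0 s a x : glob s -> glob (update s 0 a x).
Proof. by apply: glob_eq => i b lt_i; rewrite updE. Qed.

Lemma glob_agree l s s' :
  agree l s s' -> all (fun j => fr j \notin l) (iota 0 6) ->
  glob s -> glob s'.
Proof.
move=> ag /allP Hl; apply: glob_eq => j a ltj.
by rewrite ag //; apply: Hl; rewrite mem_iota.
Qed.

(** The nonlinear comparisons needed below, collected so that [lia] can treat the products as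
    atoms. *)
Lemma sizes :
  [/\ 0 < N, N <= N * n * k, n <= N * n * k, k <= N * n * k
    & [/\ n * k <= N * n * k, N * n <= N * n * k, N * k <= N * n * k,
          n <= n * k & k <= n * k]].
Proof.
have N0 : 0 < N by rewrite expn_gt0 n_gt0.
move: N N0 => N' N0.
have H1 : 0 < n * k by rewrite muln_gt0 n_gt0.
have H2 : n * k <= N' * n * k by rewrite -mulnA leq_pmull.
have H3 : n <= n * k by rewrite leq_pmulr.
have H4 : k <= n * k by rewrite leq_pmull.
have H5 : N' * n <= N' * n * k by rewrite leq_pmulr.
have H6 : N' * k <= N' * n * k by rewrite mulnAC leq_pmulr.
have H7 : N' <= N' * k by rewrite leq_pmulr.
by split; last split; lia.
Qed.

Definition has_digit (c y i : nat) : bool := has (fun j => dig n c j == y) (iota 0 i).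

(** Filtering the range yields a sorted list without sorting and drops repetitions, so its length is
    k exactly when the k digits are distinct. *)
Definition emc (c : nat) : seq nat := [seq y <- iota 0 n | has_digit c y k].

Lemma has_digitS c y i : has_digit c y i.+1 = has_digit c y i || (dig n c i == y).
Proof. by rewrite /has_digit -addn1 iotaD has_cat /= orbF. Qed.

Lemma pow_le i : i <= k -> n ^ i <= N.
Proof. by move=> lei; rewrite leq_pexp2l. Qed.

Ltac leaf :=
  rewrite ?updE /=;
  first [ eassumption
        | match goal with
          | H : forall i, is_true (i < _) -> ?s ?a i = _ |- ?s ?a _ = _ =>
              apply: H; lia
          end
        | reflexivity ].
Ltac ev :=
  lazymatch goal with
  | |- eval _ _ _ (Cst _) = _ => apply: ev_cst; lia
  | |- eval _ _ _ (Get _ _) = _ => eapply ev_get; [ev | leaf | try lia]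
  | |- eval _ _ _ (Inp _) = _ => eapply ev_inp; [ev | try reflexivity | try lia]
  | |- eval _ _ _ (Bin _ _ _) = _ =>
      eapply ev_bin; [ev | ev | rewrite /=; reflexivity | try lia]
  | |- eval _ _ _ (digitE _) = _ => rewrite /digitE; ev
  | _ => idtac
  end.
Ltac step :=
  lazymatch goal with
  | |- wp _ _ (Seq (Put _ _ _) _) _ _ _ =>
      eapply wp_put_seq; [ev | ev | rewrite /=; try lia | rewrite /=]
  | |- wp _ _ (Put _ _ _) _ _ _ =>
      eapply wp_put; [ev | ev | rewrite /=; try lia | rewrite /=]
  | |- wp _ _ (If _ _ _) _ _ _ =>
      eapply wp_if; [ev | rewrite /=; try lia | rewrite /= | rewrite /=]
  end.
Ltac notin := rewrite /= ?mem_cat ?inE ?frE ?fr0E ?fr0E' /=; done.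

Lemma scan_wp s c y :
  glob s -> s (fr 6) 0 = c -> c < N -> s (fr 8) 0 = y -> y < n ->
  s (fr 9) 0 = 0 -> s (fr 10) 0 = 0 ->
  wp w I (While (Bin Lt (V 10) (V 1)) scan) (40 * k)
    (fun s' => s' (fr 9) 0 = has_digit c y k) s.
Proof.
move=> G Ec lt_c Ey lt_y Ef Ei; have [N0 *] := sizes.
apply: (@wp_while _ _ _ _ k 25
  (fun i s' => [/\ i <= k, s' (fr 10) 0 = i & s' (fr 9) 0 = has_digit c y i])).
- by split.
- by rewrite /=; lia.
move=> i s' [le_i Ei' Ef'] ag.
have [G0 G1 G2 [G3 G4 G5]] : glob s' by apply: glob_agree ag _ G; notin.
have Ec' : s' (fr 6) 0 = c by rewrite ag //; notin.
have Ey' : s' (fr 8) 0 = y by rewrite ag //; notin.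
have [lt_i|ge_i] := ltnP i k; [right | left]; last first.
  have -> : k = i by lia.
  split=> //; etransitivity; [ev | lia].
have pi := pow_le le_i.
have ld := dig_lt n_gt0 c i.
have lq : c %/ n ^ i < 2 ^ w by apply: leq_ltn_trans (leq_div _ _) _; lia.
split=> //.
  suff -> : eval w I s' (Bin Lt (V 10) (V 1)) = (i < k) by rewrite lt_i.
  ev.
rewrite /scan; apply: (@wp_seq _ _ 17 _ _ _
  (fun s => s (fr 10) 0 = i /\ s (fr 9) 0 = has_digit c y i.+1)) => //.
  step; rewrite -/(dig n c i); try lia.
  - move=> E; step; rewrite !updE /= has_digitS; split=> //.
    by move: E; case: (dig n c i =P y) => //; rewrite orbT.
  - move=> E; apply: wp_skip => //.
    by split=> //; rewrite Ef' has_digitS; move: E; case: (dig n c i =P y) => //; rewrite orbF.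
move=> s1 [E1 E2] ag1.
have G0' : s1 (fr 0) 0 = n by rewrite ag1 //; notin.
step; rewrite !updE /=; split; lia.
Qed.

(** Serves both the arguments of the checker, with p = 1, and the output, where the first clause
    protects the sets already printed. *)
Lemma emit_wp s c p :
  glob s -> s (fr 6) 0 = c -> c < N -> s (fr 7) 0 = p -> p + n < 2 ^ w ->
  wp w I emit (100 * (n * k))
    (fun s' => [/\ forall j, j < p -> s' 0 j = s 0 j,
       forall j, j < size (emc c) -> s' 0 (p + j) = nth 0 (emc c) j
       & s' (fr 7) 0 = p + size (emc c)]) s.
Proof.
move=> G Ec lt_c Ep lt_p; have [N0 ? ? ? [? ? ? ? ?]] := sizes.
rewrite /emit; step.
set s0 := update _ _ _ _.
pose L y := [seq z <- iota 0 y | has_digit c z k].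
have leL y : size (L y) <= y.
  by rewrite size_filter; apply: leq_trans (count_size _ _) _; rewrite size_iota.
have LS y : L y.+1 = L y ++ if has_digit c y k then [:: y] else [::].
  by rewrite /L -addn1 iotaD filter_cat /= add0n; case: ifP.
apply: (@wp_while _ _ _ _ n (70 * k)
  (fun y s' => [/\ y <= n, s' (fr 8) 0 = y, s' (fr 7) 0 = p + size (L y),
    forall j, j < p -> s' 0 j = s 0 j &
    forall j, j < size (L y) -> s' 0 (p + j) = nth 0 (L y) j])).
- by split; rewrite /s0 ?updE //= ?addn0 // => j ltj; rewrite updE.
- by rewrite /=; lia.
move=> y s' [le_y Ey' Ep' Hlo HL] ag.
have G' : glob s' by apply: (glob_agree ag); [notin | rewrite /s0; apply: glob_upd].
have [G0 G1 G2 [G3 G4 G5]] := G'.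
have [lt_y|ge_y] := ltnP y n; [right | left]; last first.
  have Ey : y = n by lia.
  by rewrite Ey in Ey' Ep' HL; split=> //; etransitivity; [ev | lia].
have lel := leL y.
have Ec' : s' (fr 6) 0 = c.
  by rewrite ag; [rewrite /s0 updE | notin].
split=> //.
  suff -> : eval w I s' (Bin Lt (V 8) (V 0)) = (y < n) by rewrite lt_y.
  ev.
rewrite /emit_body; step; step.
eapply wp_seq.
- by apply: (@scan_wp _ c y); rewrite ?updE //; do 2!apply: glob_upd => //.
- lia.
move=> s1 /= Ef ag1.
have s1E a : a \notin [:: fr 9; fr 10] -> s1 a = s' a.
  rewrite !inE negb_or => /andP[/negbTE a9 /negbTE a10].
  by rewrite ag1 ?/update ?a9 ?a10 // !inE a9 a10.
have E7 : s1 (fr 7) 0 = p + size (L y) by rewrite s1E //; notin.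
have E8 : s1 (fr 8) 0 = y by rewrite s1E //; notin.
have E0 j : s1 0 j = s' 0 j by rewrite s1E //; notin.
apply: (@wp_seq _ _ 14 _ _ _ (fun s2 => [/\ s2 (fr 8) 0 = y,
    s2 (fr 7) 0 = p + size (L y.+1),
    forall j, j < p -> s2 0 j = s 0 j &
    forall j, j < size (L y.+1) -> s2 0 (p + j) = nth 0 (L y.+1) j])).
- step.
  + rewrite LS; case: (has_digit c y k) => [_|/eqP//]; rewrite size_cat /=.
    step; step; rewrite !updE /=; split; rewrite ?updE //=; first lia.
      move=> j lt_j; rewrite !updE E0 Hlo //.
      by have -> : (j == p + size (L y)) = false by lia.
    move=> j lt_j; rewrite !updE eqn_add2l nth_cat E0.
    have [lt_j'|ge_j] := ltnP j (size (L y)).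
      by rewrite HL //; have -> : (j == size (L y)) = false by lia.
    have -> : j = size (L y) by lia.
    by rewrite eqxx subnn.
  + rewrite LS; case: (has_digit c y k) => [//|_]; rewrite cats0.
    by apply: wp_skip => //; split=> // j lt_j; rewrite E0; [apply: Hlo | apply: HL].
- lia.
move=> s2 [F8 F7 Flo FL] ag2.
by step; rewrite !updE /= addn1; split=> // j lt_j; rewrite !updE; [apply: Flo | apply: FL].
Qed.

Hypotheses (nE_eval : forall s, eval w I s nE = n) (nE_cost : cost nE <= 5).
Hypotheses (size_codeA : size codeA = k) (size_codeB : size codeB = k).
Hypotheses (codeA_lt : forall i, i < k -> nth 0 codeA i < n)
           (codeB_lt : forall i, i < k -> nth 0 codeB i < n).

Local Notation num := (numeral n codeA).

Hypothesis caE : ca = num k.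

Lemma init_wp s :
  stored s (k :: codeA ++ codeB) -> wp w I init (100 * k) glob s.
Proof.
move=> st; have [N0 ? ? ? [? ? ? ? ?]] := sizes.
have lk : k < 2 ^ w by lia.
have s00 : s 0 0 = k by apply: st.
have sA i : i < k -> s 0 (i + 1) = nth 0 codeA i.
  move=> lt_i; rewrite addn1 st /=; first by rewrite nth_cat size_codeA lt_i.
  by rewrite size_cat size_codeA size_codeB; lia.
have sB i : i < k -> s 0 (i + (k + 1)) = nth 0 codeB i.
  move=> lt_i; rewrite addn1 addnS st /=; last first.
    by rewrite size_cat size_codeA size_codeB; lia.
  by rewrite nth_cat size_codeA ltnNge leq_addl addnK.
rewrite /init; step; first exact: nE_eval.
step; step; step; step.
set s1 := update _ _ _ _.
have E1 j : s1 0 j = s 0 j by rewrite /s1 !updE.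
apply: (@wp_while _ _ _ _ k 42 (fun i s' => [/\ i <= k, s' (fr 10) 0 = i,
    s' (fr 3) 0 = n ^ i, s' (fr 4) 0 = num i &
    forall j, j < i -> s' (fr 2) j = n ^ j /\ s' (fr 5) j = nth 0 codeB j])).
- by split; rewrite // /s1 !updE.
- by rewrite /=; lia.
move=> i s' [le_i E10 E3 E4 Earr] ag.
have E0 : s' (fr 0) 0 = n by rewrite ag; [rewrite /s1 !updE | notin].
have E1' : s' (fr 1) 0 = k by rewrite ag; [rewrite /s1 !updE | notin].
have Es j : s' 0 j = s 0 j by rewrite ag; [rewrite E1 | notin].
have [lt_i|ge_i] := ltnP i k; [right | left]; last first.
  have Ei : i = k by lia.
  rewrite Ei in E10 E3 E4 Earr.
  split; first by etransitivity; [ev | lia].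
  split=> //; first by move=> j /Earr[].
  by split; rewrite ?caE // => j /Earr[].
have sAi : s' 0 (i + 1) = nth 0 codeA i by rewrite Es sA.
have sBi : s' 0 (i + (k + 1)) = nth 0 codeB i by rewrite Es sB.
have lA := codeA_lt lt_i; have lB := codeB_lt lt_i.
have p1 := pow_le le_i; have p2 := pow_le lt_i.
have n2 := numeral_lt n_gt0 codeA_lt lt_i; rewrite /= in n2.
split=> //.
  suff -> : eval w I s' (Bin Lt (V 10) (V 1)) = (i < k) by rewrite lt_i.
  ev.
rewrite /init_body; step; step; step; step.
  by rewrite -expnSr; lia.
step; rewrite !updE /=; split=> //; rewrite ?expnSr ?addn1 //.
move=> j lt_j; rewrite !updE /=.
have [->|ne] := eqVneq j i; first by [].
by apply: Earr; lia.
Qed.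

Lemma compare_wp s L :
  glob s -> size L = k -> (forall i, i < k -> nth 0 L i < n) ->
  (forall i, i < k -> s 0 (i + 1) = nth 0 L i) ->
  wp w I compare (50 * k) (fun s' => s' (fr 20) 0 = (L == codeB)) s.
Proof.
move=> G szL L_lt EL; have [N0 ? ? ? [? ? ? ? ?]] := sizes.
rewrite /compare; step; step.
set s1 := update _ _ _ _.
pose eqto i := all (fun j => nth 0 L j == nth 0 codeB j) (iota 0 i).
have -> : (L == codeB) = eqto k.
  apply/eqP/allP => [-> // | H]; apply: (@eq_from_nth _ 0); first by rewrite szL.
  by move=> i; rewrite szL => lt_i; apply/eqP/H; rewrite mem_iota.
have eqtoS i : eqto i.+1 = eqto i && (nth 0 L i == nth 0 codeB i).
  by rewrite /eqto -addn1 iotaD all_cat /= andbT.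
apply: (@wp_while _ _ _ _ k 25 (fun i s' =>
  [/\ i <= k, s' (fr 10) 0 = i & s' (fr 20) 0 = eqto i])).
- by split; rewrite // /s1 !updE.
- by rewrite /=; lia.
move=> i s' [le_i E10 E20] ag.
have [G0 G1 G2 [G3 G4 G5]] : glob s'.
  by apply: (glob_agree ag); [notin | do 2!(apply: glob_upd => //)].
have [lt_i|ge_i] := ltnP i k; [right | left]; last first.
  have Ei : i = k by lia.
  by rewrite Ei in E10 E20; split=> //; etransitivity; [ev | lia].
have ELi : s' 0 (i + 1) = nth 0 L i by rewrite ag; [rewrite /s1 !updE EL | notin].
have lL := L_lt _ lt_i; have lB := codeB_lt lt_i.
split=> //.
  suff -> : eval w I s' (Bin Lt (V 10) (V 1)) = (i < k) by rewrite lt_i.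
  ev.
step.
step; rewrite !updE /= addn1; split=> //.
by rewrite eqtoS mulnb.
Qed.

(** * Enumeration of the nodes and calls of the checker *)

Variables (Fn : seq nat -> bool) (fk : nat).
Hypothesis writesD : forall j, (fr j \in writes D) = false.
Hypothesis FnB : Fn codeB.
Hypothesis D_runs : forall c, c < N -> size (emc c) = k ->
  runs w I D (k :: emc c) fk (fun out => out = [:: nat_of_bool (Fn (emc c))]).

Definition feas (c : nat) : bool :=
  [&& c < N, size (emc c) == k & Fn (emc c)].

Definition src (c : nat) : bool := (c < N) && (emc c == codeB).

Lemma src_feas c : src c -> feas c.
Proof.
by rewrite /src /feas => /andP[-> /eqP->]; rewrite size_codeB eqxx FnB.
Qed.

Definition sources (c : nat) : seq nat := [seq x <- iota 0 c | src x].

Lemma sourcesS c :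
  sources c.+1 = sources c ++ if src c then [:: c] else [::].
Proof. by rewrite /sources -addn1 iotaD filter_cat /= add0n; case: ifP. Qed.

Lemma size_sources c : size (sources c) <= c.
Proof.
by rewrite size_filter; apply: leq_trans (count_size _ _) _; rewrite size_iota.
Qed.

Lemma emc_lt c i : i < size (emc c) -> nth 0 (emc c) i < n.
Proof.
move=> lt_i; have : nth 0 (emc c) i \in emc c by rewrite mem_nth.
by rewrite mem_filter mem_iota => /andP[_].
Qed.

(** Sources enter the queue at once, so they count as reached and are excluded from array 11. *)
Definition enum_inv (c : nat) (s : store) : Prop :=
  [/\ s (fr 15) 0 = size (sources c),
      forall j, j < size (sources c) -> s (fr 14) j = nth 0 (sources c) j,
      forall x, x < c -> s (fr 11) x = feas x && ~~ src x
    & forall x, x < c -> s (fr 12) x = src x].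

Lemma classify_wp c s :
  glob s -> s (fr 6) 0 = c -> c < N -> enum_inv c s ->
  s (fr 7) 0 = 1 + size (emc c) ->
  (forall j, j < size (emc c) -> s 0 (j + 1) = nth 0 (emc c) j) ->
  s (fr 11) c = 0 -> s (fr 12) c = 0 ->
  wp w I classify (80 * k + fk) (enum_inv c.+1) s.
Proof.
move=> G E6 lt_c [E15 E14 E11 E12] E7 E0 z11 z12.
have [G0 G1 G2 [G3 G4 G5]] := G; have [N0 ? ? ? [? ? ? ? ?]] := sizes.
have szE : size (emc c) <= n.
  by rewrite size_filter; apply: leq_trans (count_size _ _) _; rewrite size_iota.
have szS := size_sources c.
rewrite /classify; step; last first.
  move=> E; have {}E : size (emc c) <> k by move=> Ek; move: E; rewrite Ek; case: eqP => //; lia.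
  have fc : feas c = false by rewrite /feas; case: eqP => // _; rewrite andbF.
  have sc : src c = false by apply: contraFF fc => /src_feas.
  apply: wp_skip; first lia.
  split; rewrite ?sourcesS ?sc ?cats0 // => x; rewrite ltnS leq_eqVlt.
    by case/orP=> [/eqP-> | /E11//]; rewrite fc.
  by case/orP=> [/eqP-> | /E12//]; rewrite sc.
move=> E; have {}E : size (emc c) = k by move: E; case: eqP => //; lia.
eapply wp_seq.
- apply: (@compare_wp _ (emc c)) => //.
    by move=> i lt_i; apply: emc_lt; rewrite E.
  by move=> i lt_i; apply: E0; rewrite E.
- lia.
move=> s1 /= E20 ag.
have s1E j p : j \notin [:: 20; 10] -> s1 (fr j) p = s (fr j) p.
  by rewrite !inE negb_or => /andP[j1 j2]; rewrite ag // /= !inE !frE (negbTE j1) (negbTE j2).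
have F0 : s1 (fr 0) 0 = n by rewrite s1E.
have F1 : s1 (fr 1) 0 = k by rewrite s1E.
have F6 : s1 (fr 6) 0 = c by rewrite s1E.
have F15 : s1 (fr 15) 0 = size (sources c) by rewrite s1E.
have srcE : src c = (emc c == codeB) by rewrite /src lt_c.
have feasE : feas c = Fn (emc c) by rewrite /feas lt_c E eqxx.
step.
- move=> E20'; have sc : src c by rewrite srcE; move: E20'; case: (emc c == codeB).
  have Ef := src_feas sc.
  step; step; step.
  split.
  + by rewrite !updE /= sourcesS sc size_cat.
  + move=> j; rewrite sourcesS sc size_cat /= => lt_j; rewrite !updE /= nth_cat.
    have [->|ne] := eqVneq j (size (sources c)); first by rewrite ltnn subnn.
    have lt_j' : j < size (sources c) by lia.
    by rewrite lt_j' s1E // E14.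
  + move=> x; rewrite ltnS leq_eqVlt !updE /= s1E //.
    by case/orP=> [/eqP-> | /E11//]; rewrite sc andbF.
  + move=> x; rewrite ltnS leq_eqVlt !updE /= s1E //.
    by case: eqVneq => [-> | ne] /=; [rewrite sc | apply: E12].
- move=> E20'; have sc : src c = false by rewrite srcE; move: E20'; case: (emc c == codeB).
  step.
  set s2 := update _ _ _ _.
  have st : stored s2 (k :: emc c).
    case=> [|i] lt_i; rewrite /s2 updE //=.
    by rewrite -addn1 (ag 0) /= ?inE ?fr0E' // E0.
  have [t1 [s3 [out [ex le_t st3 Eout]]]] := D_runs lt_c E st.
  apply: (@wp_seq _ _ fk _ _ _ (fun s3 => s3 0 0 = Fn (emc c))).
  + by exists t1, s3; split=> //; rewrite st3 Eout.
  + lia.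
  move=> {t1 out ex le_t st3 Eout} {}s3 E3 ag3.
  have s3E j p : j \notin [:: 20; 10] -> s3 (fr j) p = s (fr j) p.
    by move=> jn; rewrite ag3 ?writesD // /s2 updE s1E.
  have H6 : s3 (fr 6) 0 = c by rewrite s3E.
  step.
  split.
  + by rewrite !updE /= sourcesS sc cats0 s3E.
  + by move=> j; rewrite sourcesS sc cats0 => lt_j; rewrite updE /= s3E // E14.
  + move=> x; rewrite ltnS leq_eqVlt !updE /= s3E //.
    by case: eqVneq => [-> | ne] /=; [rewrite sc feasE andbT | apply: E11].
  + move=> x; rewrite ltnS leq_eqVlt !updE /= s3E //.
    by case: eqVneq => [-> | ne] /=; [rewrite sc z12 | apply: E12].
Qed.

Lemma enumerate_wp s :
  glob s -> wp w I enumerate (300 * (N * n * k) + N * fk)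
    (fun s' => glob s' /\ enum_inv N s') s.
Proof.
move=> G; have [N0 ? ? ? [? ? ? ? ?]] := sizes.
rewrite /enumerate; step; step.
set s1 := update _ _ _ _.
apply: (@wp_while _ _ _ _ N (200 * (n * k) + fk)
  (fun c s' => [/\ c <= N, s' (fr 6) 0 = c & enum_inv c s'])).
- by split; rewrite /s1 ?updE //; split=> //; rewrite !updE.
- rewrite /=.
  have -> : N * (200 * (n * k) + fk + 5).+1 = 200 * (N * n * k) + N * fk + 6 * N.
    by move: (n ^ k) => p; lia.
  lia.
move=> c s' [le_c E6 Inv] ag.
have G' : glob s'.
  apply: (glob_agree ag); last by do 2!(apply: glob_upd => //).
  by rewrite /= !(mem_cat, inE, frE, fr0E, fr0E', writesD).
have [G0 G1 G2 [G3 G4 G5]] := G'.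
have [lt_c|ge_c] := ltnP c N; [right | left]; last first.
  have Ec : c = N by lia.
  rewrite Ec in E6 Inv.
  by split=> //; etransitivity; [ev | lia].
split=> //.
  suff -> : eval w I s' (Bin Lt (V 6) (V 3)) = (c < N) by rewrite lt_c.
  ev.
rewrite /enumerate_body; step.
eapply wp_seq.
- apply: (@emit_wp _ c 1); rewrite ?updE //; [exact: glob_upd | lia].
- lia.
move=> s2 [_ H0 H7] ag2.
have s2E j p : j \notin [:: 7; 8; 9; 10] -> s2 (fr j) p = s' (fr j) p.
  move=> jn; have j7 : (j == 7) = false by apply: contraNF jn => /eqP->.
  rewrite ag2 ?updE ?j7 //.
  by move: jn; rewrite /= !inE !frE !fr0E !negb_or; do 4 case: eqP => //.
have H6 : s2 (fr 6) 0 = c by rewrite s2E.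
step; step.
set s3 := update _ _ _ _.
have G3' : glob s3.
  do 2!(apply: glob_upd => //); apply: (glob_agree ag2); first by notin.
  exact: glob_upd.
eapply wp_seq.
- apply: (@classify_wp c s3) => //; rewrite /s3 ?updE //= ?eqxx //.
    case: Inv => E15 E14 E11 E12; split; rewrite ?updE ?s2E //=.
    + by move=> j lt_j; rewrite !updE /= s2E // E14.
    + by move=> x lt_x; rewrite !updE /= (ltn_eqF lt_x) s2E // E11.
    + by move=> x lt_x; rewrite !updE /= (ltn_eqF lt_x) s2E // E12.
  by move=> j lt_j; rewrite !updE addnC H0.
- lia.
move=> s4 Inv4 ag4.
have K6 : s4 (fr 6) 0 = c.
  rewrite ag4; first by rewrite /s3 !updE.
  by rewrite /= !(mem_cat, inE, frE, fr0E, fr0E', writesD).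
step; rewrite !updE /= addn1; split=> //.
case: Inv4 => E15 E14 E11 E12.
by split; rewrite ?updE // => x lt_x; rewrite updE /=; auto.
Qed.

(** * The search loops and their invariant *)

Variable adjn : rel nat.
Hypothesis adjE_eval : forall s x y, glob s ->
  s (fr 18) 0 = x -> s (fr 8) 0 = y -> x < n -> y < n ->
  (eval w I s adjE != 0) = adjn x y.
Hypothesis adjE_cost : cost adjE <= 200.

Definition nb (u c : nat) : Prop :=
  exists i y, [/\ i < k, y < n, adjn (dig n u i) y & c = rep n u i y].

(* The three nested loops of [search] are at positions h, i0 and y0. *)
Definition tried (h i0 y0 j i y : nat) : bool :=
  (j < h) || (j == h) && ((i < i0) || (i == i0) && (y < y0)).

(** Completeness so far. Once h is the size of the queue, it says that the queue is closed under
    feasible neighbours. *)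
Definition closed (h i0 y0 : nat) (Q : seq nat) (d : nat -> nat) : Prop :=
  forall j i y, tried h i0 y0 j i y -> j < size Q -> i < k -> y < n ->
    adjn (dig n (nth 0 Q j) i) y -> feas (rep n (nth 0 Q j) i y) ->
    reached Q d (nth 0 Q j) (rep n (nth 0 Q j) i y).

Definition queue (Q : seq nat) (h i y : nat) (s : store) : Prop :=
  [/\ s (fr 15) 0 = size Q,
      forall j, j < size Q -> s (fr 14) j = nth 0 Q j,
      forall c, c < N -> s (fr 11) c = feas c && (c \notin Q),
      forall c, c < N -> c \notin Q -> s (fr 12) c = 0
    & bfs feas src nb Q h (s (fr 12)) (s (fr 13))
      /\ closed h i y Q (s (fr 12))].

Lemma queue_eq Q h i y s s' :
  (forall j, 11 <= j <= 15 -> s' (fr j) = s (fr j)) ->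
  queue Q h i y s -> queue Q h i y s'.
Proof. by move=> E; rewrite /queue !E. Qed.

Lemma queue_upd Q h i y s j a x : ~~ (11 <= j <= 15) ->
  queue Q h i y s -> queue Q h i y (update s (fr j) a x).
Proof.
move=> jn; apply: queue_eq => i' i'n; rewrite /update frE.
by have -> : (i' == j) = false by apply: contraNF jn => /eqP<-.
Qed.

Lemma closed_step h i y Q d :
  closed h i y Q d ->
  (adjn (dig n (nth 0 Q h) i) y -> feas (rep n (nth 0 Q h) i y) ->
     reached Q d (nth 0 Q h) (rep n (nth 0 Q h) i y)) ->
  closed h i y.+1 Q d.
Proof.
move=> cl new j i' y' tr.
have [E|ne] := boolP ((j == h) && (i' == i) && (y' == y)).
  by case/andP: E => /andP[/eqP-> /eqP->] /eqP->.
by apply: cl; move: tr ne; rewrite /tried; lia.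
Qed.

Lemma closed_push h i y Q d d' c :
  h < size Q -> c \notin Q -> (forall a, a != c -> d' a = d a) ->
  closed h i y Q d -> closed h i y (rcons Q c) d'.
Proof.
move=> lt_h cQ dE cl j i' y' tr _ lt_i' lt_y'.
have lt_j : j < size Q by move: tr; rewrite /tried; lia.
rewrite nth_rcons lt_j => ad fe.
have [rQ le_d] := cl j i' y' tr lt_j lt_i' lt_y' ad fe.
have neq a : a \in Q -> a != c by apply: contraL => /eqP->.
by split; rewrite ?mem_rcons ?inE ?rQ ?orbT // !dE ?neq ?mem_nth.
Qed.

(** A queue of distinct numbers below N; this bounds the rounds of the outer loop although the queue
    grows while it is processed. *)
Lemma queue_size Q h i y s : queue Q h i y s -> size Q <= N.
Proof.
case=> _ _ _ _ [b _]; rewrite -[leqRHS](size_iota 0).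
apply: uniq_leq_size; first exact: bfs_uniq b.
by move=> c /(bfs_feas b)/and3P[lt_c _ _]; rewrite mem_iota.
Qed.

Lemma visit_wp h i y u s :
  glob s -> i < k -> y < n -> s (fr 10) 0 = i -> s (fr 8) 0 = y ->
  u < N -> s (fr 17) 0 = u -> s (fr 18) 0 = dig n u i ->
  s (fr 19) 0 = u - dig n u i * n ^ i ->
  (exists Q, [/\ queue Q h i y s, h < size Q & nth 0 Q h = u]) ->
  wp w I visit 260 (fun s' => s' (fr 8) 0 = y.+1 /\
    exists Q, [/\ queue Q h i y.+1 s', h < size Q & nth 0 Q h = u]) s.
Proof.
move=> G lt_i lt_y E10 E8 lt_u E17 E18 E19 [Q [q lt_h Eu]].
have [N0 ? ? ? [? ? ? ? ?]] := sizes; have [G0 G1 G2 [G3 G4 G5]] := G.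
have szQ := queue_size q.
have [E15 E14 E11 E12 [b cl]] := q.
have lt_c := rep_lt n_gt0 lt_u lt_i lt_y.
have uQ : u \in Q by rewrite -Eu mem_nth.
have le_yn : y * n ^ i <= rep n u i y by rewrite leq_addl.
have /andP[d_gt0 d_le] := bfs_dist b uQ.
have ltid : index u Q < size Q by rewrite index_mem.
have pi := pow_le (ltnW lt_i).
have lt_d := dig_lt n_gt0 u i.
rewrite /visit; step; rewrite -/(rep n u i y).
set c := rep n u i y in lt_c le_yn *.
set s1 := update _ _ _ _.
have G1' : glob s1 by apply: glob_upd.
have q1 : queue Q h i y s1 by apply: queue_upd.
have s1E j p : j != 6 -> s1 (fr j) p = s (fr j) p by rewrite /s1 updE => /negbTE->.
have F6 : s1 (fr 6) 0 = c by rewrite /s1 !updE.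
apply: (@wp_seq _ _ 240 _ _ _ (fun s2 => s2 (fr 8) 0 = y /\
    exists Q, [/\ queue Q h i y.+1 s2, h < size Q & nth 0 Q h = u])); last first.
- move=> s2 [E8' [Q' [q' lt_h' Eu']]] ag.
  step; rewrite !updE /= addn1; split=> //; exists Q'; split=> //.
  exact: queue_upd.
- by [].
(* Common to all branches without a push: a feasible neighbour already in the queue is close enough
   by [bfs_head]. *)
have skip : (adjn (dig n u i) y -> feas c -> c \in Q) ->
    s1 (fr 8) 0 = y /\
    exists Q, [/\ queue Q h i y.+1 s1, h < size Q & nth 0 Q h = u].
  move=> inQ; split; first by rewrite s1E.
  exists Q; split=> //; case: q1 => ? ? ? ? [b1 cl1]; split=> //; split=> //.
  apply: closed_step => // ad fe; rewrite Eu in ad fe *.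
  have cQ := inQ ad fe; split=> //.
  by rewrite -[u in X in _ <= X]Eu; apply: bfs_head b1 lt_h _ cQ.
have F11 : s1 (fr 11) c = feas c && (c \notin Q) by rewrite s1E // E11.
step; last first.
  move=> E; apply: wp_skip => //; apply: skip => _ fe.
  by move: E; rewrite fe /=; case: (c \in Q).
move=> E; have [fe cQ] : feas c /\ c \notin Q by move: E; case: (feas c); case: (c \in Q).
have ad := adjE_eval G1' (etrans (s1E 18 0 isT) E18) (etrans (s1E 8 0 isT) E8) lt_d lt_y.
(* [adjE] is an abstract expression: its value stays unevaluated and only whether it is nonzero is
   used. *)
eapply wp_if; [reflexivity | lia | |]; last first.
  move=> E0; apply: wp_skip; first lia.
  by apply: skip => ad'; move: ad; rewrite E0 ad'.
rewrite ad => {}ad.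
have F17 : s1 (fr 17) 0 = u by rewrite s1E.
have F15 : s1 (fr 15) 0 = size Q by rewrite s1E.
have F12 : s1 (fr 12) u = s (fr 12) u by rewrite s1E.
clear E F11 skip.
do 5 step.
set s2 := update _ _ _ _.
split; first by rewrite /s2 !updE /= s1E.
case: q1 => [H15 H14 H11 H12 [b1 cl1]].
have d'E a : a != c -> s2 (fr 12) a = s1 (fr 12) a.
  by move=> ne; rewrite /s2 !updE /= (negbTE ne).
have d'c : s2 (fr 12) c = (s1 (fr 12) u).+1 by rewrite /s2 !updE /= eqxx F12 addn1.
exists (rcons Q c); split.
- split.
  + by rewrite /s2 !updE /= size_rcons addn1.
  + move=> j; rewrite size_rcons ltnS /s2 !updE /= nth_rcons leq_eqVlt => lt_j.
    by case: eqVneq lt_j => [->|ne] /= lt_j; rewrite ?ltnn // lt_j H14.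
  + move=> x lt_x; rewrite /s2 !updE /= mem_rcons inE.
    by case: eqVneq => [->|ne] /=; rewrite ?andbF // H11.
  + move=> x lt_x; rewrite mem_rcons inE negb_or => /andP[xc xQ].
    by rewrite d'E // H12.
  split.
  + apply: (bfs_push lt_h b1 fe cQ) => //; rewrite ?Eu.
    * by exists i, y.
    * exact: d'c.
    * by rewrite /s2 !updE /= eqxx.
    * by move=> x ne; rewrite /s2 !updE /= (negbTE ne).
  + apply: closed_step; first exact: closed_push lt_h cQ d'E cl1.
    move=> _ _; rewrite nth_rcons lt_h Eu -/c; split; first by rewrite mem_rcons inE eqxx.
    rewrite d'c ltnS leq_eqVlt d'E ?eqxx //.
    by apply: contraNneq cQ => <-.
- by rewrite size_rcons ltnS ltnW.
- by rewrite nth_rcons lt_h.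
Qed.

Lemma row_wp h i u s :
  glob s -> i < k -> s (fr 10) 0 = i -> u < N -> s (fr 17) 0 = u ->
  (exists Q, [/\ queue Q h i 0 s, h < size Q & nth 0 Q h = u]) ->
  wp w I row (400 * n) (fun s' => s' (fr 10) 0 = i.+1 /\
    exists Q, [/\ queue Q h i.+1 0 s', h < size Q & nth 0 Q h = u]) s.
Proof.
move=> G lt_i E10 lt_u E17 [Q [q lt_h Eu]].
have [N0 ? ? ? [? ? ? ? ?]] := sizes; have [G0 G1 G2 [G3 G4 G5]] := G.
have pi := pow_le (ltnW lt_i).
have lt_d := dig_lt n_gt0 u i; have le_d := dig_le n u i.
have lq : u %/ n ^ i < 2 ^ w by apply: leq_ltn_trans (leq_div _ _) _; lia.
rewrite /row; step; rewrite -/(dig n u i).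
step; step.
set s1 := update _ _ _ _.
have G1' : glob s1 by do 3!(apply: glob_upd => //).
apply: (@wp_seq _ _ (n * 266 + 6) _ _ _ (fun s2 => exists Q,
   [/\ queue Q h i.+1 0 s2, h < size Q & nth 0 Q h = u])); last first.
- move=> s2 [Q' [q' lt_h' Eu']] ag.
  have F10 : s2 (fr 10) 0 = i by rewrite ag; [rewrite /s1 !updE | notin].
  step; rewrite !updE /= addn1; split=> //.
  by exists Q'; split=> //; apply: queue_upd.
- lia.
apply: (@wp_while _ _ _ _ n 260 (fun y s' => [/\ y <= n, s' (fr 8) 0 = y
   & exists Q, [/\ queue Q h i y s', h < size Q & nth 0 Q h = u]])).
- split; rewrite ?/s1 ?updE //.
  by exists Q; split=> //; do 3!(apply: queue_upd => //).
- by rewrite /=; lia.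
move=> y s' [le_y E8 ex] ag.
have G' : glob s' by apply: (glob_agree ag); [notin | ].
have [G0' G1'' G2' [G3' G4' G5']] := G'.
have [lt_y|ge_y] := ltnP y n; [right | left]; last first.
  have Ey : y = n by lia.
  split; first by etransitivity; [ev | lia].
  case: ex => Q' [q' lt_h' Eu']; exists Q'; split=> //; rewrite Ey in q'.
  case: q' => ? ? ? ? [b cl]; split=> //; split=> //.
  (* Positions (i, n) and (i + 1, 0) leave the same pairs behind, as y' < n. *)
  move=> j i' y' tr lt_j lt_i' lt_y'; apply: cl => //.
  by move: tr; rewrite /tried; lia.
split=> //.
  suff -> : eval w I s' (Bin Lt (V 8) (V 0)) = (y < n) by rewrite lt_y.
  ev.
have F10 : s' (fr 10) 0 = i by rewrite ag; [rewrite /s1 !updE | notin].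
have F17 : s' (fr 17) 0 = u by rewrite ag; [rewrite /s1 !updE | notin].
have F18 : s' (fr 18) 0 = dig n u i by rewrite ag; [rewrite /s1 !updE | notin].
have F19 : s' (fr 19) 0 = u - dig n u i * n ^ i.
  by rewrite ag; [rewrite /s1 !updE | notin].
apply: wp_weaken (visit_wp G' lt_i lt_y F10 E8 lt_u F17 F18 F19 ex) _ _ => //.
by move=> s3 [E83 Q3] _; split.
Qed.

Lemma expand_wp h s :
  glob s -> s (fr 16) 0 = h ->
  (exists2 Q, queue Q h 0 0 s & h < size Q) ->
  wp w I expand (500 * (n * k)) (fun s' => s' (fr 16) 0 = h.+1 /\
    exists2 Q, queue Q h.+1 0 0 s' & h < size Q) s.
Proof.
move=> G E16 [Q q lt_h].
have [N0 ? ? ? [? ? ? ? ?]] := sizes; have [G0 G1 G2 [G3 G4 G5]] := G.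
have szQ := queue_size q; have [E15 E14 E11 E12 [b cl]] := q.
set u := nth 0 Q h.
have lt_u : u < N by have /(bfs_feas b)/and3P[] : u \in Q by rewrite mem_nth.
have E14h : s (fr 14) h = u by rewrite E14.
rewrite /expand; step; step.
set s1 := update _ _ _ _.
apply: (@wp_seq _ _ (k * (400 * n + 6) + 6) _ _ _ (fun s2 => exists Q,
   [/\ queue Q h k 0 s2, h < size Q & nth 0 Q h = u])); last first.
- move=> s2 [Q' [q' lt_h' Eu']] ag.
  have szQ' := queue_size q'.
  have F16 : s2 (fr 16) 0 = h by rewrite ag; [rewrite /s1 !updE | notin].
  step; rewrite !updE /= addn1; split=> //.
  exists Q' => //; apply: queue_upd => //.
  case: q' => ? ? ? ? [b' cl']; split=> //; split; first exact: bfs_next.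
  move=> j i' y' tr lt_j lt_i' lt_y'; apply: cl' => //.
  by move: tr; rewrite /tried; lia.
- lia.
apply: (@wp_while _ _ _ _ k (400 * n) (fun i s' => [/\ i <= k, s' (fr 10) 0 = i
   & exists Q, [/\ queue Q h i 0 s', h < size Q & nth 0 Q h = u]])).
- split; rewrite ?/s1 ?updE //.
  by exists Q; split=> //; do 2!(apply: queue_upd => //).
- by rewrite /=; lia.
move=> i s' [le_i E10 ex] ag.
have G' : glob s'.
  by apply: (glob_agree ag); [notin | do 2!(apply: glob_upd => //)].
have [G0' G1' G2' [G3' G4' G5']] := G'.
have [lt_i|ge_i] := ltnP i k; [right | left]; last first.
  have Ei : i = k by lia.
  by rewrite Ei in ex; split=> //; etransitivity; [ev | lia].
split=> //.
  suff -> : eval w I s' (Bin Lt (V 10) (V 1)) = (i < k) by rewrite lt_i.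
  ev.
have F17 : s' (fr 17) 0 = u by rewrite ag; [rewrite /s1 !updE | notin].
apply: wp_weaken (row_wp G' lt_i E10 lt_u F17 ex) _ _ => //.
by move=> s3 [E103 Q3] _; split.
Qed.

Lemma search_wp s :
  glob s -> enum_inv N s ->
  wp w I search (600 * (N * n * k)) (fun s' => glob s' /\
    exists Q, queue Q (size Q) 0 0 s') s.
Proof.
move=> G [E15 E14 E11 E12].
have [N0 ? ? ? [? ? ? ? ?]] := sizes; have [G0 G1 G2 [G3 G4 G5]] := G.
have has_digitS' c : (c \in sources N) = src c.
  by rewrite mem_filter mem_iota /= /src add0n andbC; case: (c < N).
rewrite /search; step.
set s1 := update _ _ _ _.
apply: (@wp_while _ _ _ _ N (500 * (n * k)) (fun h s' => [/\ s' (fr 16) 0 = h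
   & exists2 Q, queue Q h 0 0 s' & h <= size Q])).
- split; first by rewrite /s1 !updE.
  exists (sources N) => //; apply: queue_upd => //.
  split=> //.
  + by move=> c lt_c; rewrite E11 // has_digitS'.
  + by move=> c lt_c; rewrite has_digitS' E12 // => /negbTE->.
  split; last by move=> j i y; rewrite /tried; lia.
  apply: bfs_init => //; first by rewrite filter_uniq ?iota_uniq.
  + exact: src_feas.
  + by move=> c sc; rewrite E12 ?sc //; case/andP: sc.
- rewrite /=.
  have -> : N * (500 * (n * k) + 5).+1 = 500 * (N * n * k) + 6 * N.
    by move: (n ^ k) => p; lia.
  lia.
move=> h s' [E16 [Q q le_h]] ag.
have G' : glob s'.
  by apply: (glob_agree ag); [notin | apply: glob_upd => //].
have szQ := queue_size q.
have F15 : s' (fr 15) 0 = size Q by case: q.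
have [lt_h|ge_h] := ltnP h (size Q); [right | left]; last first.
  have Eh : h = size Q by lia.
  split; first by etransitivity; [ev | lia].
  by split=> //; exists Q; rewrite -Eh.
split; first lia.
  suff -> : eval w I s' (Bin Lt (V 16) (V 15)) = (h < size Q) by rewrite lt_h.
  ev.
exact: expand_wp G' E16 (ex_intro2 _ _ Q q lt_h).
Qed.

(** Everything the graph side needs to know about a run: a finished search, closed under feasible
    neighbours, and the words printed from it. *)
Definition outcome (out : seq nat) : Prop :=
  exists Q d par, [/\ bfs feas src nb Q (size Q) d par,
    forall u c, u \in Q -> nb u c -> feas c -> reached Q d u c
    & out = if ca \in Q
            then 1 :: (d ca).-1 ::
                 flatten [seq emc (iter j par ca) | j <- iota 0 (d ca)]
            else [:: 0]].

Lemma output_wp s :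
  glob s -> (exists Q, queue Q (size Q) 0 0 s) ->
  wp w I output (200 * (N * n * k))
    (fun s' => exists2 out, stored s' out & outcome out) s.
Proof.
move=> G [Q q].
have [N0 ? ? ? [? ? ? ? ?]] := sizes; have [G0 G1 G2 [G3 G4 G5]] := G.
have szQ := queue_size q; have [E15 E14 E11 E12 [b cl]] := q.
have lt_ca : ca < N by rewrite caE (numeral_lt n_gt0 codeA_lt).
(* Every position of a finished queue lies before its head, so [closed] covers all nodes. *)
have cl' u c : u \in Q -> nb u c -> feas c -> reached Q (s (fr 12)) u c.
  move=> uQ [i [y [lt_i lt_y ad ->]]] fe.
  have E := nth_index 0 uQ; rewrite -[X in reached _ _ X]E -[X in rep _ X]E.
  by apply: cl; rewrite ?E // /tried index_mem uQ.
rewrite /output.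
have [caQ|caQ] := boolP (ca \in Q); last first.
  have Ed : s (fr 12) ca = 0 by rewrite E12.
  step=> // _; step.
  exists [:: 0]; first by case=> // _; rewrite updE.
  by exists Q, (s (fr 12)), (s (fr 13)); rewrite (negbTE caQ).
set d := s (fr 12) in b cl cl' *; set par := s (fr 13) in b *.
have /andP[d_gt0 d_le] := bfs_dist b caQ.
have le_dN : d ca <= N.
  by apply: leq_trans szQ; apply: leq_trans d_le _; rewrite index_mem.
have Ed : s (fr 12) ca = d ca by [].
step; last by lia.
move=> _; do 6 step.
set s1 := update _ _ _ _.
have G1' : glob s1 by do 4!(apply: glob_upd => //); do 2!apply: glob_upd0.
pose out j := 1 :: (d ca).-1 :: flatten [seq emc (iter j par ca) | j <- iota 0 j].
have size_em j : j < d ca -> size (emc (iter j par ca)) = k.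
  move=> lt_j; have [jQ _] := bfs_chain b caQ lt_j.
  by have /and3P[_ /eqP-> _] := bfs_feas b jQ.
have outS j : out j.+1 = out j ++ emc (iter j par ca).
  by rewrite /out -(addn1 j) iotaD map_cat flatten_cat /= cats0.
have size_out j : j <= d ca -> size (out j) = 2 + k * j.
  elim: j => [|j IH] lt_j; first by rewrite muln0.
  by rewrite outS size_cat IH 1?ltnW // size_em // mulnS; lia.
apply: (@wp_while _ _ _ _ N (120 * (n * k)) (fun j s' => [/\ j <= d ca,
   s' (fr 20) 0 = j, s' (fr 7) 0 = 2 + k * j, stored s' (out j)
   & j < d ca -> s' (fr 6) 0 = iter j par ca])).
- split; rewrite // /s1 ?updE ?muln0 //.
  by case=> [|[|//]] _; rewrite !updE //= subn1.
- rewrite /=.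
  have -> : N * (120 * (n * k) + 5).+1 = 120 * (N * n * k) + 6 * N.
    by move: (n ^ k) => p; lia.
  lia.
move=> j s' [le_j E20 E7 st E6] ag.
have G' : glob s' by apply: (glob_agree ag); [notin | ].
have F21 : s' (fr 21) 0 = d ca by rewrite ag; [rewrite /s1 !updE | notin].
have [lt_j|ge_j] := ltnP j (d ca); [right | left]; last first.
  have Ej : j = d ca by lia.
  split; first by etransitivity; [ev | lia].
  exists (out (d ca)); first by rewrite -Ej.
  by exists Q, d, par; rewrite caQ.
have {}E6 := E6 lt_j.
have [jQ dj] := bfs_chain b caQ lt_j.
have lt_c : iter j par ca < N by have /and3P[] := bfs_feas b jQ.
have lekj : k * j <= N * k by rewrite mulnC leq_mul2r; apply/orP; right; lia.
split; first lia.
  suff -> : eval w I s' (Bin Lt (V 20) (V 21)) = (j < d ca) by rewrite lt_j.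
  ev.
eapply wp_seq.
- by apply: (emit_wp G' E6 lt_c E7); lia.
- lia.
move=> s2 [Hlo Hem H7] ag2.
have F20 : s2 (fr 20) 0 = j by rewrite ag2 //; notin.
have F13 x : s2 (fr 13) x = par x.
  by rewrite ag2; [rewrite ag; [rewrite /s1 !updE | notin] | notin].
have F6 : s2 (fr 6) 0 = iter j par ca by rewrite ag2 //; notin.
(* In the last round the parent of a source is read, an arbitrary word. Its value is therefore left
   unevaluated, and the invariant speaks of array 6 only while a set remains to be printed. *)
eapply wp_put_seq; [ev | reflexivity | rewrite /=; lia | rewrite /=].
step; rewrite !updE /= addn1; split=> //.
- by rewrite H7 size_em // mulnS; lia.
- move=> i lt_i; rewrite !updE.
  move: lt_i; rewrite outS size_cat nth_cat size_out // => lt_i.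
  case: ltnP => ge_i; first by rewrite Hlo // st // size_out.
  rewrite -Hem; last by lia.
  by congr (s2 0 _); lia.
- move=> lt_j1.
  have [j1Q _] := bfs_chain b caQ lt_j1.
  have lt_c1 : par (iter j par ca) < N by have /and3P[] := bfs_feas b j1Q.
  have Hc : iter j par ca < 2 ^ w by lia.
  by rewrite mod0n F6 (modn_small Hc) F13 modn_small //; lia.
Qed.

Lemma main_wp s :
  stored s (k :: codeA ++ codeB) ->
  wp w I main (1300 * (N * n * k) + N * fk)
    (fun s' => exists2 out, stored s' out & outcome out) s.
Proof.
move=> st; have [N0 ? ? ? [? ? ? ? ?]] := sizes.
rewrite /main; eapply wp_seq; [exact: init_wp st | lia |].
move=> s1 G1 _; eapply wp_seq; [exact: enumerate_wp G1 | lia |].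
move=> s2 [G2 E2] _; eapply wp_seq; [exact: search_wp G2 E2 | lia |].
move=> s3 [G3 Q3] _; apply: wp_weaken (output_wp G3 Q3) _ _ => //; lia.
Qed.

End Correctness.
End Program.

(** * Encoding of graphs *)

Section Enumeration.
Variables (T : finType) (x0 : T).
Local Notation n := #|T|.

Definition el (i : nat) : T := nth x0 (enum T) i.

Lemma el_rank x : el (enum_rank x) = x.
Proof. by rewrite /el nth_enum_rank. Qed.

Lemma rank_el i : i < n -> enum_rank (el i) = i :> nat.
Proof.
move=> lt_i; have -> : el i = enum_val (Ordinal lt_i).
  by rewrite (enum_val_nth x0).
by rewrite enum_valK.
Qed.

Lemma rank_inj (x y : T) :
  (nat_of_ord (enum_rank x) == enum_rank y) = (x == y).
Proof. by rewrite (inj_eq val_inj) (inj_eq enum_rank_inj). Qed.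

(** Brings [code] into the shape of [emc]: enumeration goes in the order of ranks. *)
Lemma codeE (X : {set T}) : code X = [seq i <- iota 0 n | el i \in X].
Proof.
have <- : [seq nat_of_ord (enum_rank x) | x <- enum T] = iota 0 n.
  apply: (@eq_from_nth _ 0); first by rewrite size_map size_iota -cardE.
  move=> i; rewrite size_map -cardE => lt_i.
  by rewrite (nth_map x0) -?cardE // nth_iota // add0n -/(el i) rank_el.
rewrite filter_map /code; have -> : enum X = [seq x <- enum T | x \in X].
  by rewrite enumT.
by congr map; apply: eq_filter => x; rewrite /= el_rank.
Qed.

Lemma size_code (X : {set T}) : size (code X) = #|X|.
Proof. by rewrite size_map -cardE. Qed.

Lemma mem_code (X : {set T}) x : (nat_of_ord (enum_rank x) \in code X) = (x \in X).
Proof.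
apply/mapP/idP => [[y]|xX]; last by exists x; rewrite ?mem_enum.
by rewrite mem_enum => yX /val_inj/enum_rank_inj->.
Qed.

Lemma code_lt (X : {set T}) i : i < #|X| -> nth 0 (code X) i < n.
Proof.
rewrite -size_code => /(mem_nth 0)/mapP[x _ ->]; exact: ltn_ord.
Qed.

Lemma code_inj : injective (@code T).
Proof. by move=> X Y E; apply/setP => x; rewrite -!mem_code E. Qed.

End Enumeration.

Lemma nth_flatten_uniform (A : Type) (a : A) (m : nat) (ss : seq (seq A)) i j :
  all (fun l => size l == m) ss -> i < size ss -> j < m ->
  nth a (flatten ss) (i * m + j) = nth a (nth [::] ss i) j.
Proof.
elim: ss i => // l ss IH [|i] /= /andP[/eqP sz_l sz] lt_i lt_j.
  by rewrite nth_cat sz_l lt_j.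
rewrite nth_cat sz_l mulSn -addnA ltnNge leq_addr /= addKn.
exact: IH.
Qed.

Section Encoding.
Variable G : sgraph.

Lemma nth_encode_adj (x0 : G) i j : i < #|G| -> j < #|G| ->
  nth 0 (encode G) (2 + (i * #|G| + j)) = adj (el x0 i) (el x0 j).
Proof.
move=> lt_i lt_j; rewrite /encode add2n /=.
pose B x := [seq nat_of_bool (adj x y) | y <- enum G].
have sB : all (fun l => size l == #|G|) [seq B x | x <- enum G].
  by apply/allP => l /mapP[x _ ->]; rewrite size_map -cardE.
have lt_ij : i * #|G| + j < #|G| * #|G|.
  apply: (@leq_trans (i.+1 * #|G|)); last by rewrite leq_mul2r lt_i orbT.
  by rewrite mulSn addnC ltn_add2r.
rewrite nth_cat size_allpairs -cardE lt_ij.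
rewrite (@nth_flatten_uniform _ _ #|G|) // ?size_map -?cardE //.
by rewrite (nth_map x0) -?cardE // (nth_map x0) -?cardE.
by rewrite -enumT -cardE.
Qed.

Lemma size_ends (e : edge G) : #|ends e| = 2.
Proof.
case: e => /= e /imset2P[x y _]; rewrite !inE /= => xy ->.
by rewrite cards2; case: eqP xy => // ->; rewrite adj_irrefl.
Qed.

Lemma nth_encode_ends (e0 : edge G) i b : i < #|edge G| -> b < 2 ->
  nth 0 (encode G) (2 + (#|G| * #|G| + (i * 2 + b))) = nth 0 (code (ends (el e0 i))) b.
Proof.
move=> lt_i lt_b; rewrite /encode add2n /=.
rewrite nth_cat size_allpairs -cardE ltnNge leq_addr /= addKn.
rewrite (@nth_flatten_uniform _ _ 2) ?size_map -?cardE //.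
- by rewrite (nth_map e0) // -cardE.
- by apply/allP => l /mapP[e _ ->]; rewrite size_map -cardE size_ends.
by rewrite -enumT -cardE.
Qed.

Lemma size_encode : size (encode G) = 2 + (#|G| * #|G| + #|edge G| * 2).
Proof.
rewrite /encode /= size_cat size_allpairs -cardE add2n size_flatten.
rewrite /shape -map_comp sumnE big_map.
under eq_bigr do rewrite /= size_map -cardE size_ends.
by rewrite big_enum /= sum_nat_const.
Qed.

(** Each edge has exactly two endpoints, so four comparisons decide in constant time whether two
    edges meet. *)
Lemma ends_meet (e1 e2 : edge G) :
  let c1 := code (ends e1) in let c2 := code (ends e2) in
  (ends e1 :&: ends e2 != set0) =
  ((nth 0 c1 0 == nth 0 c2 0) || (nth 0 c1 0 == nth 0 c2 1)
   || ((nth 0 c1 1 == nth 0 c2 0) || (nth 0 c1 1 == nth 0 c2 1))).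
Proof.
move=> c1 c2.
have [a [b E1]] : exists a b, c1 = [:: a; b].
  have : size c1 = 2 by rewrite size_code size_ends.
  by case: c1 => [|a [|b []]] // _; exists a, b.
have [c [d E2]] : exists a b, c2 = [:: a; b].
  have : size c2 = 2 by rewrite size_code size_ends.
  by case: c2 => [|a' [|b' []]] // _; exists a', b'.
have -> : (ends e1 :&: ends e2 != set0) = has (mem c2) c1.
  apply/set0Pn/hasP => [[x /setIP[x1 x2]]|[_ /mapP[x + ->] x2]].
    by exists (nat_of_ord (enum_rank x)); rewrite /= mem_code.
  by rewrite mem_enum => x1; exists x; rewrite inE x1 -mem_code.
by rewrite E1 E2 /= !inE orbF.
Qed.

End Encoding.

(** * Token moves and the constant-time test for them *)

Definition radj (v : variant) (r : rule) (G : sgraph) : rel (element v G) :=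
  match r with TJ => fun x y => x != y | TS => @element_adj v G end.

Lemma radj_sym v r G : symmetric (@radj v r G).
Proof.
case: r => x y /=; first by rewrite eq_sym.
by case: v x y => x y /=; rewrite ?(adj_sym x) // eq_sym setIC.
Qed.

Lemma radj_neq v r G (x y : element v G) : radj r x y -> x != y.
Proof.
case: r => //=; case: v x y => x y /=; last by case/andP.
  by apply: contraTneq => ->; rewrite adj_irrefl.
by apply: contraTneq => ->; rewrite adj_irrefl.
Qed.

(** One form for both rules. Under TJ the condition on x and y is automatic: x lies in X but not in
    Y, and y conversely. *)
Lemma reconf_adjP v r G (X Y : {set element v G}) :
  reflect (exists x y, [/\ X :\: Y = [set x], Y :\: X = [set y] & radj r x y])
          (reconf_adj r X Y).
Proof.
apply: (iffP idP); case: r => /=.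
- move=> /andP[/cards1P[x Ex] /cards1P[y Ey]]; exists x, y; split=> //.
  have : x \in X :\: Y by rewrite Ex set11.
  have : y \in Y :\: X by rewrite Ey set11.
  rewrite !inE => /andP[yX _] /andP[_ xX].
  by apply: contraNneq yX => <-.
- by case/existsP=> x /existsP[y /and3P[/eqP Ex /eqP Ey xy]]; exists x, y.
- by case=> x [y [-> -> _]]; rewrite !cards1.
- by case=> x [y [-> -> xy]]; apply/existsP; exists x; apply/existsP; exists y; rewrite !eqxx.
Qed.

Lemma reconf_adj_sym v r G : symmetric (@reconf_adj v r G).
Proof.
move=> X Y; apply/reconf_adjP/reconf_adjP => [][x [y [Ex Ey xy]]];
  by exists y, x; rewrite radj_sym.
Qed.

Definition endE (e : expr) (b : nat) : expr :=
  Inp (Bin Add (Cst 2) (Bin Add (Bin Mul (Inp (Cst 0)) (Inp (Cst 0)))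
                         (Bin Add (Bin Mul e (Cst 2)) (Cst b)))).

Section Lookup.
Variables (w : nat) (G : sgraph) (s : store).
Hypothesis word_gt : 100 + size (encode G) < 2 ^ w.
Local Notation ev := (eval w (encode G) s).

Lemma adjE_eval (x0 : G) e1 e2 e3 i j :
  ev e1 = i -> ev e2 = j -> ev e3 = #|G| -> i < #|G| -> j < #|G| ->
  ev (Inp (Bin Add (Cst 2) (Bin Add (Bin Mul e1 e3) e2))) =
  adj (el x0 i) (el x0 j).
Proof.
move=> E1 E2 E3 lt_i lt_j; have := nth_encode_adj x0 lt_i lt_j.
have : i * #|G| + j < #|G| * #|G|.
  apply: (@leq_trans (i.+1 * #|G|)); last by rewrite leq_mul2r lt_i orbT.
  by rewrite mulSn addnC ltn_add2r.
have := word_gt; rewrite size_encode.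
move: E3; have [m Em] : exists m, m = #|G| by eexists.
rewrite -!Em; move: (m * m) => p E3 lt_w lt_p nthE.
apply: (ev_inp (i := 2 + (i * m + j))) => //; last by case: adj; lia.
apply: (ev_bin (x := 2) (y := i * m + j)) => //.
- by apply: ev_cst; lia.
- apply: (ev_bin (x := i * m) (y := j)) => //; last by lia.
  by apply: (ev_bin E1 E3 erefl); rewrite /=; lia.
- by lia.
Qed.

Lemma endE_eval (e0 : edge G) e i b :
  ev e = i -> i < #|edge G| -> b < 2 ->
  ev (endE e b) = nth 0 (code (ends (el e0 i))) b.
Proof.
move=> Ee lt_i lt_b; have := word_gt; rewrite size_encode.
have lt_v : nth 0 (code (ends (el e0 i))) b < #|G|.
  by apply: code_lt; rewrite size_ends.
have := nth_encode_ends e0 lt_i lt_b.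
have : #|G| <= #|G| * #|G| by case: #|G| => // m; rewrite leq_pmulr.
move Ep: (#|G| * #|G|) => p le_p nthE lt_w.
apply: (ev_inp (i := 2 + (p + (i * 2 + b)))) => //; last by lia.
have E0 : ev (Inp (Cst 0)) = #|G|.
  by apply: (ev_inp (i := 0)) => //; [apply: ev_cst; lia | lia].
apply: (ev_bin (x := 2) (y := p + (i * 2 + b))) => //.
- by apply: ev_cst; lia.
- apply: (ev_bin (x := p) (y := i * 2 + b)) => //; last by lia.
    by apply: (ev_bin (o := Mul) E0 E0 Ep); lia.
  apply: (ev_bin (x := i * 2) (y := b)) => //; last by lia.
    have E2 : ev (Cst 2) = 2 by apply: ev_cst; lia.
    by apply: (ev_bin Ee E2 erefl); rewrite /=; lia.
  by apply: ev_cst; lia.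
- by lia.
Qed.

Lemma ev_eq e1 e2 x y : ev e1 = x -> ev e2 = y -> ev (Bin Eq e1 e2) = (x == y).
Proof.
by move=> E1 E2; apply: (ev_bin E1 E2 erefl); rewrite /=; case: eqP; lia.
Qed.

End Lookup.

Section AdjacencyTest.
Variables (v : variant) (r : rule) (M : nat).
Local Notation V j := (Get (fr M j) (Cst 0)).

Definition sizeE : expr :=
  Inp (Cst (match v with Edge => 1 | _ => 0 end)).

(** Only being nonzero matters, so products act as conjunctions and sums as disjunctions. The factor
    for distinctness is there because an edge shares its endpoints with itself. *)
Definition radjE : expr :=
  match r, v with
  | TJ, _ => Bin Eq (Bin Eq (V 18) (V 8)) (Cst 0)
  | TS, Edge =>
      Bin Mul (Bin Eq (Bin Eq (V 18) (V 8)) (Cst 0))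
        (Bin Add
          (Bin Add (Bin Eq (endE (V 18) 0) (endE (V 8) 0))
                   (Bin Eq (endE (V 18) 0) (endE (V 8) 1)))
          (Bin Add (Bin Eq (endE (V 18) 1) (endE (V 8) 0))
                   (Bin Eq (endE (V 18) 1) (endE (V 8) 1))))
  | TS, _ => Inp (Bin Add (Cst 2) (Bin Add (Bin Mul (V 18) (V 0)) (V 8)))
  end.

Variables (w : nat) (G : sgraph) (x0 : element v G).
Hypothesis word_gt : 100 + size (encode G) < 2 ^ w.

Lemma element_bound : #|element v G| <= size (encode G).
Proof.
rewrite size_encode; case: v x0 => x1 /=; [..|lia];
by have : 0 < #|G|; [apply/card_gt0P; exists x1 | nia].
Qed.

Lemma sizeE_eval s : eval w (encode G) s sizeE = #|element v G|.
Proof.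
have := element_bound; rewrite /sizeE => lt; apply: ev_inp.
- by apply: ev_cst; case: v; lia.
- by case: v.
- lia.
Qed.

Lemma sizeE_cost : cost sizeE <= 5.
Proof. by []. Qed.

Lemma radjE_cost : cost radjE <= 200.
Proof. by rewrite /radjE; case: r; case: v. Qed.

Lemma radjE_eval s i j :
  s (fr M 0) 0 = #|element v G| -> s (fr M 18) 0 = i -> s (fr M 8) 0 = j ->
  i < #|element v G| -> j < #|element v G| ->
  (eval w (encode G) s radjE != 0) = radj r (el x0 i) (el x0 j).
Proof.
move=> E0 E18 E8 lt_i lt_j; have le_n := element_bound.
have neqE : (el x0 i == el x0 j) = (i == j) by rewrite -rank_inj !rank_el.
have ev_i : eval w (encode G) s (V 18) = i.
  by apply: ev_get E18 _; [apply: ev_cst; lia | lia].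
have ev_j : eval w (encode G) s (V 8) = j.
  by apply: ev_get E8 _; [apply: ev_cst; lia | lia].
have ev_n : eval w (encode G) s (V 0) = #|element v G|.
  by apply: ev_get E0 _; [apply: ev_cst; lia | lia].
have ev_0 : eval w (encode G) s (Cst 0) = 0 by apply: ev_cst; lia.
have ev_neq : eval w (encode G) s (Bin Eq (Bin Eq (V 18) (V 8)) (Cst 0)) = (i != j).
  by rewrite (ev_eq word_gt (ev_eq word_gt ev_i ev_j) ev_0); case: (i == j).
rewrite /radjE /radj; case: r; first by rewrite ev_neq neqE; case: (i == j).
case: v x0 lt_i lt_j ev_n neqE => x1 lt_i lt_j ev_n neqE.
- by rewrite (adjE_eval word_gt x1 ev_i ev_j ev_n) //=; case: adj.
- by rewrite (adjE_eval word_gt x1 ev_i ev_j ev_n) //=; case: adj.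
have ev_i0 := endE_eval word_gt x1 ev_i lt_i (isT : 0 < 2).
have ev_i1 := endE_eval word_gt x1 ev_i lt_i (isT : 1 < 2).
have ev_j0 := endE_eval word_gt x1 ev_j lt_j (isT : 0 < 2).
have ev_j1 := endE_eval word_gt x1 ev_j lt_j (isT : 1 < 2).
have E00 := ev_eq word_gt ev_i0 ev_j0.
have E01 := ev_eq word_gt ev_i0 ev_j1.
have E10 := ev_eq word_gt ev_i1 ev_j0.
have E11 := ev_eq word_gt ev_i1 ev_j1.
rewrite /element_adj ends_meet neqE.
move: E00 E01 E10 E11; set b00 := _ == _; set b01 := _ == _; set b10 := _ == _.
set b11 := _ == _ => E00 E01 E10 E11.
have Ea := ev_bin (o := Add) E00 E01 erefl.
have Eb := ev_bin (o := Add) E10 E11 erefl.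
have {}Ea := Ea ltac:(rewrite /=; case: (b00); case: (b01); lia).
have {}Eb := Eb ltac:(rewrite /=; case: (b10); case: (b11); lia).
have Ec := ev_bin (o := Add) Ea Eb erefl.
have {}Ec := Ec ltac:(rewrite /=; case: (b00); case: (b01); case: (b10); case: (b11); lia).
have Ed := ev_bin (o := Mul) ev_neq Ec erefl.
rewrite {}Ed /=; first by case: (i == j); case: (b00); case: (b01); case: (b10); case: (b11).
by case: (i == j); case: (b00); case: (b01); case: (b10); case: (b11); lia.
Qed.
End AdjacencyTest.

(** * Correctness *)

Section Reconfiguration.
Variables (v : variant) (r : rule) (Pi : sgraph -> Prop) (G : sgraph).
Local Notation T := (element v G).
Variables (x0 : T) (k : nat) (A B : {set T}) (F : {set T} -> bool).
Local Notation n := #|T|.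
Hypotheses (k_gt0 : 0 < k) (cardA : #|A| = k) (cardB : #|B| = k).
Hypothesis FP : forall X : {set T}, #|X| = k -> F X <-> feasible Pi X.

Definition decode (c : nat) : {set T} :=
  [set x | has_digit n c (enum_rank x) k].

(** The verdict on sets, transported to lists of numbers, the only objects that the program half
    knows. *)
Definition on_code (l : seq nat) : bool :=
  F [set x : T | nat_of_ord (enum_rank x) \in l].

Definition radj_code (i j : nat) : bool := radj r (el x0 i) (el x0 j).

Lemma n_gt0 : 0 < n.
Proof. by apply/card_gt0P; exists x0. Qed.

Lemma on_codeE X : on_code (code X) = F X.
Proof. by congr F; apply/setP => x; rewrite inE mem_code. Qed.

Lemma code_decode c : code (decode c) = emc n k c.
Proof.
rewrite (codeE x0); apply: eq_in_filter => i; rewrite mem_iota => /andP[_ lt_i].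
by rewrite inE rank_el.
Qed.

Lemma size_emc c : size (emc n k c) = #|decode c|.
Proof. by rewrite -code_decode size_code. Qed.

Lemma feasE c :
  feas n k on_code c = [&& c < n ^ k, #|decode c| == k & F (decode c)].
Proof. by rewrite /feas size_emc -code_decode on_codeE. Qed.

Lemma srcE c : src n k (code B) c = (c < n ^ k) && (decode c == B).
Proof. by rewrite /src -code_decode (inj_eq (@code_inj T)). Qed.

(* Writing a solution as one digit plus [others] makes a token move the
   exchange of a single element. *)
Definition others (c i : nat) : {set T} :=
  [set el x0 (dig n c j) | j : 'I_k & j != i :> nat].

Lemma decode_others c i :
  i < k -> decode c = el x0 (dig n c i) |: others c i.
Proof.
move=> lt_i; apply/setP => x; rewrite !inE.
apply/hasP/orP => [[j]|].
  rewrite mem_iota => /andP[_ lt_j] /eqP E.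
  have Ex : x = el x0 (dig n c j) by rewrite E el_rank.
  have [ji|ne] := eqVneq j i; first by left; rewrite Ex ji.
  by right; apply/imsetP; exists (Ordinal lt_j); rewrite ?inE.
case=> [/eqP->|/imsetP[j _ ->]].
  by exists i; rewrite ?mem_iota //= rank_el ?dig_lt ?n_gt0.
by exists (nat_of_ord j); rewrite ?mem_iota //= rank_el ?dig_lt ?n_gt0.
Qed.

Lemma card_others c i : i < k -> #|others c i| < k.
Proof.
move=> lt_i; apply: leq_ltn_trans (leq_imset_card _ _) _.
rewrite -[X in _ < X]card_ord; apply: proper_card; apply/properP; split.
  exact/subsetP.
by exists (Ordinal lt_i); rewrite ?inE //= eqxx.
Qed.

Lemma others_rep c i y : y < n -> others (rep n c i y) i = others c i.
Proof.
move=> lt_y; apply: eq_in_imset => j; rewrite inE => ne.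
by rewrite dig_rep ?n_gt0 // (negbTE ne).
Qed.

Lemma decode_rep c i y : i < k -> y < n ->
  decode (rep n c i y) = el x0 y |: others c i.
Proof.
by move=> lt_i lt_y; rewrite (decode_others _ lt_i) others_rep // dig_rep ?n_gt0 // eqxx.
Qed.

(** Counting: the other positions name fewer than k elements, so digit i must supply a new one. *)
Lemma digit_fresh c i :
  i < k -> #|decode c| = k -> el x0 (dig n c i) \notin others c i.
Proof.
move=> lt_i; rewrite (decode_others c lt_i) cardsU1; have := card_others c lt_i.
by case: (_ \notin _) => //=; rewrite add0n => lt E; rewrite E ltnn in lt.
Qed.

Lemma setU1_diff (x y : T) (R : {set T}) :
  x != y -> x \notin R -> (x |: R) :\: (y |: R) = [set x].
Proof.
move=> xy xR; apply/setP => z; rewrite !inE negb_or.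
by case: (eqVneq z x) => [->|_] /=; [rewrite xy xR | case: (z \in R); rewrite ?andbF].
Qed.

Lemma nb_reconf u c :
  #|decode u| = k -> #|decode c| = k -> nb n k radj_code u c ->
  reconf_adj r (decode u) (decode c).
Proof.
move=> ku kc [i [y [lt_i lt_y ad Ec]]].
have fu := digit_fresh lt_i ku; have fc := digit_fresh lt_i kc.
rewrite Ec dig_rep ?n_gt0 // eqxx others_rep // in fc.
have xy := radj_neq ad; apply/reconf_adjP.
exists (el x0 (dig n u i)), (el x0 y).
rewrite Ec decode_rep // (decode_others u lt_i).
by split=> //; apply: setU1_diff; rewrite // eq_sym.
Qed.

(** The lift of a move: the digit of c that names the leaving element is overwritten, all other
    tokens keep their positions. The neighbour relation goes from c' to c because the search moves
    away from the target. *)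
Lemma reconf_nb c Y :
  c < n ^ k -> #|decode c| = k -> reconf_adj r (decode c) Y ->
  exists c', [/\ c' < n ^ k, decode c' = Y & nb n k radj_code c' c].
Proof.
move=> lt_c kc /reconf_adjP[x [y [Ex Ey xy]]].
have : x \in decode c :\: Y by rewrite Ex set11.
rewrite !inE => /andP[xY /hasP[i]]; rewrite mem_iota => /andP[_ lt_i] /eqP Ei.
have lt_x := ltn_ord (enum_rank x); have lt_y := ltn_ord (enum_rank y).
have elx : el x0 (dig n c i) = x by rewrite Ei el_rank.
have fx := digit_fresh lt_i kc; rewrite elx in fx.
exists (rep n c i (enum_rank y)); split.
- by apply: rep_lt => //; exact: n_gt0.
- rewrite decode_rep // el_rank; apply/setP => z.
  move/setP/(_ z): Ex; move/setP/(_ z): Ey.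
  rewrite (decode_others c lt_i) elx !inE.
  have [->|zx] := eqVneq z x.
    by rewrite (negbTE (radj_neq xy)) (negbTE fx) (negbTE xY).
  by case: (z == y); case: (z \in Y); case: (z \in others c i).
exists i, (enum_rank x); split=> //; last by rewrite -Ei rep_dig ?n_gt0.
by rewrite dig_rep ?n_gt0 // eqxx /radj_code !el_rank radj_sym.
Qed.

Lemma card_reconf (X Y : {set T}) : reconf_adj r X Y -> #|X| = #|Y|.
Proof.
case/reconf_adjP=> x [y [Ex Ey _]].
by rewrite -(cardsID Y X) -(cardsID X Y) Ex Ey !cards1 setIC.
Qed.

Variables (Q : seq nat) (d par : nat -> nat).
Local Notation feas := (feas n k on_code).
Local Notation nb := (nb n k radj_code).
Hypothesis search : bfs feas (src n k (code B)) nb Q (size Q) d par.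
Hypothesis complete :
  forall u c, u \in Q -> nb u c -> feas c -> reached Q d u c.

(** Induction on the sequence. Lifting its first move gives a node c' for the next set, bounded by
    induction, and expanding c' reached c. At the end the node names B in some ordering, and every
    ordering is a source. *)
Lemma dist_le p c :
  c < n ^ k -> #|decode c| = k -> reconf_seq r Pi (decode c) B p ->
  c \in Q /\ d c <= (size p).+1.
Proof.
elim: p c => [|Y p IH] c lt_c kc [/= pth last_p feasible_p].
  have sc : src n k (code B) c by rewrite srcE lt_c last_p eqxx.
  by have [cQ ->] := bfs_src search sc.
case/andP: pth => cY pth.
have [c' [lt_c' Ec' nbc]] := reconf_nb lt_c kc cY.
have kc' : #|decode c'| = k by rewrite Ec' -(card_reconf cY).
have [c'Q le_d] : c' \in Q /\ d c' <= (size p).+1.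
  apply: IH => //; rewrite Ec'; split=> // X Xp.
  by apply: feasible_p; rewrite inE Xp orbT.
have fc : feas c.
  rewrite feasE lt_c kc eqxx /=; apply/(FP kc).
  by apply: feasible_p; rewrite mem_head.
have [cQ le_d'] := complete c'Q nbc fc.
by split=> //; apply: leq_trans le_d' _; rewrite ltnS.
Qed.

Lemma chain_path c m j : c \in Q -> j + m < d c ->
  path (@reconf_adj v r G) (decode (iter j par c))
       [seq decode (iter i par c) | i <- iota j.+1 m].
Proof.
move=> cQ; elim: m j => //= m IH j lt_jm.
have [jQ dj] := bfs_chain search cQ (ltac:(lia) : j < d c).
have kd x : x \in Q -> #|decode x| = k.
  by move=> /(bfs_feas search); rewrite feasE => /and3P[_ /eqP].
apply/andP; split; last by apply: (IH j.+1); lia.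
have [[d1 _]|[pQ nbp _]] := bfs_par search jQ; first lia.
by rewrite reconf_adj_sym; apply: nb_reconf; rewrite ?kd.
Qed.

Lemma decode_numeral : decode (numeral n (code A) k) = A.
Proof.
have ltA i : i < k -> nth 0 (code A) i < n by rewrite -cardA; apply: code_lt.
apply/setP => x; rewrite inE -mem_code.
have digE i : i < k -> dig n (numeral n (code A) k) i = nth 0 (code A) i.
  by move=> lt_i; apply: (dig_numeral n_gt0 ltA lt_i).
apply/hasP/(nthP 0) => [[i]|[i]].
  rewrite mem_iota => /andP[_ lt_i] /eqP <-.
  by exists i; rewrite ?digE // size_code cardA.
rewrite size_code cardA => lt_i <-.
by exists i; rewrite ?mem_iota //= digE.
Qed.

Lemma chain_shortest : let ca := numeral n (code A) k in ca \in Q ->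
  shortest_reconf_seq r Pi A B
    [seq decode (iter i par ca) | i <- iota 1 (d ca).-1].
Proof.
move=> ca caQ; have /andP[d_gt0 _] := bfs_dist search caQ.
have lt_ca : ca < n ^ k.
  apply: numeral_lt (leqnn k); first exact: n_gt0.
  by rewrite -cardA; apply: code_lt.
have EA : A = decode ca by rewrite decode_numeral.
have kca : #|decode ca| = k by rewrite -EA.
have Ed : (d ca).-1.+1 = d ca by rewrite prednK.
split; last first.
  move=> q; rewrite EA => /(dist_le lt_ca kca)[_ le_d].
  by rewrite size_map size_iota -ltnS prednK.
split.
- by rewrite {1}EA; apply: (@chain_path _ _ 0); rewrite // add0n prednK.
- rewrite {1}EA -[decode ca]/(decode (iter 0 par ca)).
  rewrite (last_map (fun i => decode (iter i par ca))) (last_nth 0).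
  rewrite size_iota -[_ :: _]/(iota 0 (d ca).-1.+1) nth_iota // add0n.
  have [jQ dj] := bfs_chain search caQ (ltac:(lia) : (d ca).-1 < d ca).
  (* This node has distance 1; a parent would have distance 0, against [bfs_dist]. So it is a source
     and names B. *)
  have [[_ sc]|[pQ _ dp]] := bfs_par search jQ.
    by move: sc; rewrite srcE => /andP[_ /eqP].
  by have /andP[dp_gt0 _] := bfs_dist search pQ; lia.
- move=> X; rewrite {1}EA -[_ :: _]/[seq decode (iter i par ca) | i <- iota 0 (d ca).-1.+1].
  case/mapP=> j; rewrite mem_iota Ed => /andP[_ lt_j] ->.
  have [jQ _] := bfs_chain search caQ lt_j.
  by move: (bfs_feas search jQ); rewrite feasE => /and3P[_ /eqP kj /(FP kj)].
Qed.

End Reconfiguration.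

(** * From the outcome of the search to the theorem *)

Lemma outcome_correct v r Pi G (x0 : element v G) k (A B : {set element v G})
    (F : {set element v G} -> bool) out :
  0 < k -> #|A| = k -> #|B| = k ->
  (forall X : {set element v G}, #|X| = k -> F X <-> feasible Pi X) ->
  outcome #|element v G| k (numeral #|element v G| (code A) k) (code B)
    (on_code F) (radj_code r x0) out ->
  correct_output r Pi A B out.
Proof.
move=> k_gt0 cardA cardB FP [Q [d [par [search complete ->]]]].
set ca := numeral _ _ _ in search complete *.
case: ifP => [caQ|/negP caQ]; [left | right].
  have := chain_shortest k_gt0 cardA cardB FP search complete caQ.
  set p := [seq _ | _ <- _]; exists p => //.
  have /andP[d_gt0 _] := bfs_dist search caQ.
  rewrite size_map size_iota; congr [:: _, _ & flatten _].
  rewrite -{1}(prednK d_gt0) /= -{1}(decode_numeral x0 cardA) code_decode //.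
  congr (_ :: _); rewrite -map_comp; apply: eq_map => j /=.
  by rewrite code_decode.
split=> // p pth; apply: caQ.
have EA := decode_numeral x0 cardA.
have lt_ca : ca < #|element v G| ^ k.
  apply: numeral_lt (leqnn k); first exact: n_gt0.
  by rewrite -cardA; apply: code_lt.
rewrite -EA in pth.
have kca : #|decode v G k ca| = k by rewrite EA.
by have [] := dist_le FP search complete lt_ca kca pth.
Qed.

(** Array names are static, so finitely many arrays can be written. The checker may read larger
    ones: its specification holds for any memory contents. *)
Definition array_bound (D : com) : nat := \max_(a <- writes D) a.

Lemma fr_notin_writes D j : (fr (array_bound D) j \in writes D) = false.
Proof.
apply/negP => inD; have := @leq_bigmax_seq _ (writes D) xpredT id _ inD isT.
by rewrite -/(array_bound D) /fr; lia.
Qed.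

(** For k = 0 source and target are both empty: the answer is 1, then length 0, then the code of the
    empty set, which has no words. *)
Definition program (v : variant) (r : rule) (D : com) : com :=
  If (Get 0 (Cst 0))
    (main D (array_bound D) (sizeE v) (radjE v r (array_bound D)))
    (Seq (Put 0 (Cst 0) (Cst 1)) (Put 0 (Cst 1) (Cst 0))).

Lemma program_empty v r Pi G w D (A B : {set element v G}) :
  1 < 2 ^ w -> #|A| = 0 -> #|B| = 0 -> feasible Pi A ->
  runs w (encode G) (program v r D) (0 :: code A ++ code B) 100
    (correct_output r Pi A B).
Proof.
move=> lt_w /cards0_eq-> /cards0_eq-> feas0 s st.
suff [t [s' [ex le_t [out st' outP]]]] :
  wp w (encode G) (program v r D) 100 (fun s' =>
    exists2 out, stored s' out & @correct_output v r Pi G set0 set0 out) s.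
  by exists t, s', out.
have ev0 s1 : eval w (encode G) s1 (Cst 0) = 0 by apply: ev_cst; lia.
have ev1 s1 : eval w (encode G) s1 (Cst 1) = 1 by apply: ev_cst.
eapply wp_if; [| by [] | |].
- by apply: (ev_get (v := 0) (ev0 _)); [apply: st | lia].
- by [].
move=> _; eapply wp_put_seq; [exact: ev0 | exact: ev1 | by [] |].
eapply wp_put; [exact: ev1 | exact: ev0 | by [] |].
exists [:: 1; 0]; first by case=> [|[|]].
left; exists [::]; last by rewrite /= /code enum_set0.
by split=> //; split=> // X; rewrite inE => /eqP->.
Qed.

Theorem theorem1 (v : variant) (r : rule) :
  exists C : nat,
  forall (Pi : sgraph -> Prop) (f : nat -> nat) (D : com),
    graph_property Pi ->
    checks_in_time v Pi f D ->
    exists P : com,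
      solves_in_time v r Pi (fun n k => C * (n ^ k.+1 * k + n ^ k * f k)) P.
Proof.
(* 1400 covers the 1300 of [main] and the initial test of k; it counts only the program's own
   operations and so is independent of the property and the checker. In the word length, c serves
   the calls of the checker and 1000 the program's own numbers. *)
exists 1400 => Pi f D _ [c Dc]; exists (program v r D); exists (c + 1000).
move=> w G A B k feasA feasB cardA cardB big s st.
set n := #|element v G| in big *.
set t := 1400 * _ in big *.
have le_S : 2 <= size (encode G) by rewrite size_encode; lia.
have [k0|k_gt0] := posnP k.
  have st0 : stored s (0 :: code A ++ code B) by rewrite -k0.
  have lt_w : 1 < 2 ^ w by move: (size _) le_S big => S; nia.
  rewrite k0 in cardA cardB.
  have [t' [s' [out [ex le_t st' outP]]]] :=
    program_empty r D lt_w cardA cardB feasA st0.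
  exists t', s', out; split=> //; apply: leq_trans le_t _.
  rewrite /t k0 expn0 mul1n muln0 add0n.
  (* The bound is now 1400 * f 0. Running the checker on the empty set, from a store that just holds
     its arguments, shows that f 0 is at least the length of a run. *)
  have f_gt0 : 0 < f 0.
    pose X := set0 : {set element v G}.
    have cond : c * (size (encode G) + f #|X|) <= 2 ^ w.
      rewrite cards0; apply: leq_trans big.
      by rewrite /t k0 expn0 mul1n muln0 add0n; nia.
    have := Dc w G X cond (fun _ => nth 0 (#|X| :: code X)) (fun _ _ => erefl).
    rewrite cards0 => -[t1 [s1 [out1 [/exec_gt0 t1_gt0 le_t1 _ _]]]].
    exact: leq_trans le_t1.
  by lia.
have [x0 _] : exists x0, x0 \in A by apply/set0Pn; rewrite -card_gt0 cardA.
have le_kn : k <= n by rewrite -cardA max_card.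
have n_gt0 : 0 < n by apply: leq_trans le_kn.
have tE : t = 1400 * (n ^ k * n * k) + 1400 * (n ^ k * f k).
  by rewrite /t mulnDr expnSr.
have N_gt0 : 0 < n ^ k by rewrite expn_gt0 n_gt0.
have word_gt : 100 + 10 * (n ^ k * n * k) < 2 ^ w.
  apply: leq_trans big; rewrite tE.
  by move: (n ^ k * n * k) (n ^ k * f k) (size _) le_S => p q S; nia.
have word_gt' : 100 + size (encode G) < 2 ^ w.
  by apply: leq_trans big; move: (size _) le_S => S; nia.
have le_f : f k <= n ^ k * f k by rewrite leq_pmull.
have D_big : c * (size (encode G) + f k) <= 2 ^ w.
  apply: leq_trans big; rewrite tE leq_mul ?leq_addr // leq_add2l.
  by apply: leq_trans le_f _; lia.
(* Feasibility is only a proposition, but a run of the checker decides it for each set of size k;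
   finite choice collects the answers. Sets of other sizes get a dummy value. *)
have [F FP] : exists F : {set element v G} -> bool,
    forall X : {set element v G}, #|X| = k -> (F X <-> feasible Pi X).
  have /fin_all_exists[F FP] (X : {set element v G}) :
      exists b : bool, #|X| = k -> (b <-> feasible Pi X).
    have [cardX|] := eqVneq #|X| k; last by move/eqP=> ne; exists true.
    have := @Dc w G X; rewrite cardX => /(_ D_big) run.
    have [_ [_ [_ [_ _ _ [b _ bP]]]]] :=
      run (fun _ => nth 0 (k :: code X)) (fun _ _ => erefl).
    by exists b.
  by exists F.
have [_ FB] := FP B cardB.
have D_runs e : e < n ^ k -> size (emc n k e) = k ->
    runs w (encode G) D (k :: emc n k e) (f k)
      (fun out => out = [:: nat_of_bool (on_code F (emc n k e))]).
  rewrite -code_decode // size_code on_codeE => _ cardX.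
  have := @Dc w G (decode v G k e); rewrite cardX => /(_ D_big) run s1 st1.
  have [t1 [s2 [out1 [ex le_t st2 [b Eb bP]]]]] := run s1 st1.
  exists t1, s2, out1; split=> //; rewrite Eb; congr [:: nat_of_bool _].
  by apply/idP/idP => [/bP/(FP _ cardX)|/(FP _ cardX)/bP].
have szA : size (code A) = k by rewrite size_code.
have szB : size (code B) = k by rewrite size_code.
have ltA i : i < k -> nth 0 (code A) i < n by rewrite -cardA; apply: code_lt.
have ltB i : i < k -> nth 0 (code B) i < n by rewrite -cardB; apply: code_lt.
have FnB : on_code F (code B) by rewrite on_codeE; apply/(FP _ cardB).
pose M := array_bound D.
have radj_ok s1 i j :
    glob M n k (numeral n (code A) k) (code B) s1 ->
    s1 (fr M 18) 0 = i -> s1 (fr M 8) 0 = j -> i < n -> j < n ->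
    (eval w (encode G) s1 (radjE v r M) != 0) = radj_code r x0 i j.
  by case=> E0 _ _ _ E18 E8 lt_i lt_j; apply: radjE_eval E0 E18 E8 lt_i lt_j.
have main_ok := main_wp n_gt0 k_gt0 le_kn word_gt (sizeE_eval x0 word_gt')
  (sizeE_cost v) szA szB ltA ltB erefl (fr_notin_writes D) FnB D_runs radj_ok
  (radjE_cost v r M) st.
have [t1 [s' [ex le_t [out st' outP]]]] :
    wp w (encode G) (program v r D) t (fun s' =>
      exists2 out, stored s' out & outcome n k (numeral n (code A) k) (code B)
        (on_code F) (radj_code r x0) out) s.
  have p1 : n <= n ^ k * n * k by rewrite mulnAC leq_pmull // muln_gt0 N_gt0.
  apply: (wp_if (v := k)).
  - by apply: (ev_get (i := 0)); [apply: ev_cst; lia | apply: st | lia].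
  - by rewrite tE /=; lia.
  - by move=> _; apply: wp_weaken main_ok _ _ => //; rewrite tE /=; lia.
  - by move=> k0; rewrite k0 in k_gt0.
by exists t1, s', out; split=> //; apply: outcome_correct outP.
Qed.
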